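(* Let $\Gamma\in\mathcal U_\infty$. (i) If $\Gamma$ is connected, then the infinite random graph $G(\infty,\Gamma)$ is almost surely connected. (ii) If $\Gamma$ is disconnected, then $G(\infty,\Gamma)$ is almost surely disconnected.
   Context: Graphs are finite, simple, undirected, with at least one vertex, unless explicitly infinite; $v(G)=|V(G)|$, $e(G)=|E(G)|$. Graph limits. For graphs $F,G$, $t(F,G)$ is the probability that a uniformly random map $V(F)\to V(G)$ is a graph homomorphism (maps edges to edges). The set $\mathcal U$ of unlabelled graphs (isomorphism classes) is embedded as a dense subset of a compact metric space $\overline{\mathcal U}$; the elements of $\mathcal U_\infty=\overline{\mathcal U}\setminus\mathcal U$ are called graph limits, and $v(\Gamma)=\infty$ for $\Gamma\in\mathcal U_\infty$. Each $t(F,\cdot)$ extends continuously to $\overline{\mathcal U}$; a graph limit $\Gamma$ is determined by the numbers $t(F,\Gamma)$, $F$ ranging over all graphs; and a sequence $G_n$ in $\overline{\mathcal U}$ converges to $\Gamma\in\mathcal U_\infty$ iff $v(G_n)\to\infty$ and $t(F,G_n)\to t(F,\Gamma)$ for every graph $F$. (Concretely, graph limits can be identified with the families $(t_F)_F$ arising as $t_F=\lim_n t(F,G_n)$ for sequences of graphs with $v(G_n)\to\infty$ for which all these limits exist.) Connectedness of graph limits. For $\Gamma_1,\Gamma_2\in\mathcal U_\infty$ and $\alpha\in[0,1]$, $\alpha\Gamma_1\oplus(1-\alpha)\Gamma_2$ is the unique graph limit $\Gamma$ with $t(F,\Gamma)=\alpha^{v(F)}t(F,\Gamma_1)+(1-\alpha)^{v(F)}t(F,\Gamma_2)$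 for every connected graph $F$. A graph limit $\Gamma$ is disconnected if there exist $\Gamma_1,\Gamma_2\in\mathcal U_\infty$ and $\alpha\in(0,1)$ with $\Gamma=\alpha\Gamma_1\oplus(1-\alpha)\Gamma_2$; otherwise it is connected. Random graphs. A kernel on a probability space $(\mathcal S,\mu)$ is a symmetric measurable $W:\mathcal S\times\mathcal S\to[0,1]$; it represents the unique graph limit $\Gamma_W$ with $t(F,\Gamma_W)=\int_{\mathcal S^{v(F)}}\prod_{ij\in E(F)}W(x_i,x_j)\,d\mu(x_1)\cdots d\mu(x_{v(F)})$ for every graph $F$. Every graph limit is represented by some kernel. $G(\infty,\Gamma)$ is the infinite random graph with vertex set $\mathbb N=\{1,2,\dots\}$ obtained, for any kernel $W$ representing $\Gamma$, by taking i.i.d. $X_1,X_2,\dots$ with distribution $\mu$ and, conditionally given these, including each edge $ij$ ($i<j$) independently with probability $W(X_i,X_j)$. Its distribution depends only on $\Gamma$ and is characterized by $\mathbb P(G(\infty,\Gamma)\supseteq F)=t(F,\Gamma)$ for every graph $F$ with $V(F)=\{1,\dots,k\}$, $k\ge1$. *)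

(* Defs.v *)
From HB Require Import structures.
From mathcomp Require Import all_boot all_order all_algebra.
From mathcomp Require Import all_classical all_reals all_analysis.
Set Implicit Arguments.
Unset Strict Implicit.
Unset Printing Implicit Defensive.
Import Order.TTheory GRing.Theory Num.Theory.
Import numFieldNormedType.Exports.
Local Open Scope classical_set_scope.
Local Open Scope ring_scope.

(* Every finite graph is isomorphic to one on {0, ..., n-1}, so these graphs
   represent all the isomorphism classes (with repetitions). *)
Record sgraph := SGraph {
  nverts : nat;
  adj : rel 'I_nverts;
  nverts_gt0 : (0 < nverts)%N;
  adj_sym : symmetric adj;
  adj_irr : irreflexive adj }.

Definition sgraph_connected (F : sgraph) : Prop :=
  forall x y : 'I_(nverts F), connect (@adj F) x y.

Definition is_hom (F G : sgraph)
    (f : {ffun 'I_(nverts F) -> 'I_(nverts G)}) : bool :=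
  [forall x, forall y, adj x y ==> adj (f x) (f y)].

Definition hom_density (R : realType) (F G : sgraph) : R :=
  #|[pred f : {ffun 'I_(nverts F) -> 'I_(nverts G)} | is_hom f]|%:R
  / #|{: {ffun 'I_(nverts F) -> 'I_(nverts G)}}|%:R.

(* A graph limit is identified with the family of numbers t(F, Gamma): these
   families are the pointwise limits of the families t(F, G_n) for sequences
   of graphs with v(G_n) -> oo. *)
Record graph_limit (R : realType) := GraphLimit {
  tlim : sgraph -> R;
  tlimP : exists G : nat -> sgraph,
    (nverts (G n) @[n --> \oo] --> \oo) /\
    (forall F : sgraph, hom_density R F (G n) @[n --> \oo] --> tlim F) }.

(* Gam = a Gam1 (+) (1 - a) Gam2, expressed as a relation: the values at
   connected graphs determine the limit. *)
Definition is_limit_sum (R : realType) (a : R)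
    (Gam1 Gam2 Gam : graph_limit R) : Prop :=
  forall F : sgraph, sgraph_connected F ->
    tlim Gam F = a ^+ nverts F * tlim Gam1 F
                 + (1 - a) ^+ nverts F * tlim Gam2 F.

Definition limit_disconnected (R : realType) (Gam : graph_limit R) : Prop :=
  exists (Gam1 Gam2 : graph_limit R) (a : R),
    0 < a < 1 /\ is_limit_sum a Gam1 Gam2 Gam.

Definition limit_connected (R : realType) (Gam : graph_limit R) : Prop :=
  ~ limit_disconnected Gam.

Record is_kernel (R : realType) (d : measure_display) (S : measurableType d)
    (W : S -> S -> R) : Prop := IsKernel {
  kernel_sym : forall x y, W x y = W y x;
  kernel_meas : measurable_fun [set: S * S] (fun p => W p.1 p.2);
  kernel_01 : forall x y, 0 <= W x y <= 1 }.

(* The integral over S^k, in its iterated form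
   \int ... \int f(x_1, ..., x_k) dmu(x_k) ... dmu(x_1). *)
Fixpoint iter_integral (R : realType) (d : measure_display)
    (S : measurableType d) (mu : probability S R) (k : nat) :
    (k.-tuple S -> \bar R) -> \bar R :=
  match k with
  | 0 => fun f => f [tuple]
  | k'.+1 => fun f =>
      (\int[mu]_x iter_integral mu (fun t : k'.-tuple S => f [tuple of x :: t]))%E
  end.

Definition represents (R : realType) (d : measure_display)
    (S : measurableType d) (mu : probability S R) (W : S -> S -> R)
    (Gam : graph_limit R) : Prop :=
  forall F : sgraph,
    (tlim Gam F)%:E = iter_integral mu (fun x : (nverts F).-tuple S =>
      (\prod_(p : 'I_(nverts F) * 'I_(nverts F) | (p.1 < p.2)%N && adj p.1 p.2)
         W (tnth x p.1) (tnth x p.2))%:E).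

Definition mutually_independent (R : realType) (d d' : measure_display)
    (Om : measurableType d) (S : measurableType d') (P : probability Om R)
    (X : nat -> Om -> S) : Prop :=
  forall (I : seq nat) (A : nat -> set S), uniq I ->
    (forall i, measurable (A i)) ->
    (P (\bigcap_(i in [set` I]) (X i @^-1` A i))
     = \prod_(i <- I) P (X i @^-1` A i))%E.

(* The sigma-algebra sigma(X_0, X_1, ...) on Om. *)
Definition sigma_generated (d d' : measure_display)
    (Om : measurableType d) (S : measurableType d')
    (X : nat -> Om -> S) : set (set Om) :=
  <<s [set B | exists i (A : set S), measurable A /\ B = X i @^-1` A] >>.

(* Conditionally on sigma(X_0, X_1, ...), the events "ij is an edge" (i < j)
   are independent with probabilities W(X_i, X_j): for every finite set E of
   pairs, prod_{ij in E} W(X_i, X_j) is a version of the conditional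
   probability that all the pairs in E are edges. *)
Definition cond_independent_edges (R : realType) (d d' : measure_display)
    (Om : measurableType d) (S : measurableType d') (P : probability Om R)
    (W : S -> S -> R) (X : nat -> Om -> S) (G : Om -> rel nat) : Prop :=
  forall E : seq (nat * nat), uniq E -> all (fun e => e.1 < e.2)%N E ->
  forall B : set Om, sigma_generated X B ->
    P (B `&` [set w | all (fun e => G w e.1 e.2) E])
    = (\int[P]_(w in B) (\prod_(e <- E) W (X e.1 w) (X e.2 w))%:E)%E.

(* G is a random simple graph on nat, defined on (Om, P) and obtained from
   Gam by the construction of G(oo, Gam), for some kernel representing Gam. *)
Definition is_G_infty (R : realType) (d : measure_display)
    (Om : measurableType d) (P : probability Om R) (Gam : graph_limit R)
    (G : Om -> rel nat) : Prop :=
  [/\ forall w, symmetric (G w), forall w, irreflexive (G w),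
      forall i j, measurable [set w | G w i j]
    & exists (d' : measure_display) (S : measurableType d')
        (mu : probability S R) (W : S -> S -> R) (X : nat -> Om -> S),
      [/\ is_kernel W /\ represents mu W Gam,
          forall i, measurable_fun setT (X i),
          forall i (A : set S), measurable A -> P (X i @^-1` A) = mu A,
          mutually_independent P X
        & cond_independent_edges P W X G]].

Definition igraph_connected (e : rel nat) : Prop :=
  forall i j : nat, exists2 p : seq nat, path e i p & last i p = j.

(* Main.v *)
Require Import Defs.
From HB Require Import structures.
From mathcomp Require Import all_boot all_order all_algebra.
From mathcomp Require Import all_classical all_reals all_analysis.
From mathcomp Require Import measurable_realfun perm fingroup ring lra.
Import Order.TTheory GRing.Theory Num.Theory.
Import numFieldNormedType.Exports.
Set Implicit Arguments.
Unset Strict Implicit.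
Unset Printing Implicit Defensive.
Local Open Scope classical_set_scope.
Local Open Scope ring_scope.

(** The random graph enters only through the identity
    P(G contains F) = t(F, Gam), for every finite graph F placed injectively on
    the vertices ([prob_subgraph]). Inverting these containment probabilities
    over the up-sets of edge sets ([upsum_cvg]) shows that they determine the
    law of the restriction of G to any n vertices, and that this law depends
    continuously on the numbers t(F, Gam); in particular it is invariant under
    relabelling of the vertices ([graph_law_exchangeable]). Both halves of the
    theorem are then proved with finite graphs.

    Let Gam = a Gam1 (+) (1-a) Gam2, where Gam1 and Gam2 are limits of graphs
    G1_m and G2_m. The disjoint unions of G1_m and G2_m, with total vertex weight
    a on the first part and 1-a on the second, have subgraph densities that
    converge to those of Gam: for connected F by the definition of the sum, for
    general F because densities are multiplicative over disjoint unions
    ([mixture_cvg]). So the restriction of G to n vertices is the limit in law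
    of samples from these unions. In such a sample, vertices that are joined by
    a path come from the same part, so that the first j vertices all lie in one
    component with probability at most a^j + (1-a)^j. This bound is uniform in n,
    hence it also bounds the probability that the first j vertices lie in one
    component of G, and it tends to 0 with j ([disconnected_ae]).

    Conversely suppose that two given vertices have probability q > 0 of being
    in different components of G. By exchangeability the expected proportion
    of disconnected pairs among the first n vertices is at least q (1 - 1/n), for
    all large n. The subgraph densities of the restriction to these vertices
    have means that tend to t(F, Gam) and, by t(F + F, Gam) = t(F, Gam)^2,
    variances that tend to 0 ([variance_hom_density]). Averaging a single
    expression that rewards disconnected pairs and penalises the deviations
    of densities yields finite graphs H_m which converge to Gam and have a
    proportion at least q/2 of disconnected pairs ([exists_fragmented_graph]).
    Colouring the components of H_m by fair coins gives a cut that no edge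
    crosses and whose two sides both have a positive proportion of the vertices
    ([component_cut]). For connected F the density t(F, H_m) is then exactly the
    mixture of the densities in the two sides, and passing to the limit along
    an ultrafilter exhibits Gam as a mixture of two graph limits
    ([limit_disconnected_of_nonconn]). Hence for connected Gam every pair of
    vertices is almost surely connected ([connected_ae]). *)

(** * Homomorphism densities in vertex-weighted graphs *)

Definition rel_hom (V T : finType) (e : rel V) (g : rel T) (f : {ffun V -> T}) :=
  [forall x, forall y, e x y ==> g (f x) (f y)].

Lemma rel_homP (V T : finType) (e : rel V) (g : rel T) (f : {ffun V -> T}) :
  reflect (forall x y, e x y -> g (f x) (f y)) (rel_hom e g f).
Proof.
apply: (iffP forallP) => [H x y|H x]; last by apply/forallP => y; apply/implyP/H.
by move/forallP: (H x) => /(_ y) /implyP.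
Qed.

(** Weights are needed since a disjoint union of two finite graphs has the
    proportion a on one side only for suitable sizes, and rational a. General
    finite types, rather than ordinals, make sums and subtypes available as
    vertex sets. *)
Definition wdensity (R : realType) (V T : finType) (p : T -> R) (e : rel V) (g : rel T) : R :=
  \sum_(f : {ffun V -> T} | rel_hom e g f) \prod_x p (f x).

Lemma hom_densityE (R : realType) (F G : sgraph) :
  hom_density R F G = wdensity (fun=> (nverts G)%:R^-1) (@adj F) (@adj G).
Proof.
rewrite /hom_density /wdensity card_ffun !card_ord.
rewrite [in RHS](eq_bigr (fun=> ((nverts G)%:R ^+ nverts F)^-1)); last first.
  by move=> f _; rewrite prodr_const card_ord exprVn.
by rewrite sumr_const natrX [LHS]mulr_natl.
Qed.

Lemma wdensity_ge0 (R : realType) (V T : finType) (p : T -> R) (e : rel V) (g : rel T) :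
  (forall t, 0 <= p t) -> 0 <= wdensity p e g.
Proof. by move=> p0; apply: sumr_ge0 => f _; apply: prodr_ge0. Qed.

Lemma sum_ffun_prod (R : realType) (V T : finType) (p : T -> R) :
  \sum_(f : {ffun V -> T}) \prod_x p (f x) = (\sum_t p t) ^+ #|V|.
Proof. by rewrite -(bigA_distr_bigA (fun _ => p)) prodr_const. Qed.

Lemma wdensity_le1 (R : realType) (V T : finType) (p : T -> R) (e : rel V) (g : rel T) :
  (forall t, 0 <= p t) -> \sum_t p t = 1 -> wdensity p e g <= 1.
Proof.
move=> p0 p1; rewrite -[leRHS](expr1n R #|V|) -p1 -sum_ffun_prod /wdensity big_mkcond/=.
by apply: ler_sum => f _; case: ifP => // _; apply: prodr_ge0.
Qed.

Lemma wdensity_eq (R : realType) (V T : finType) (p p' : T -> R) (e e' : rel V) (g g' : rel T) :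
  p =1 p' -> e =2 e' -> g =2 g' -> wdensity p e g = wdensity p' e' g'.
Proof.
move=> Ep Ee Eg; apply: eq_big => [f|f _]; last by apply: eq_bigr.
by apply: eq_forallb => x; apply: eq_forallb => y; rewrite Ee Eg.
Qed.

Lemma wdensity_bijl (R : realType) (V V' T : finType) (h : V' -> V)
    (p : T -> R) (e : rel V) (g : rel T) :
  bijective h -> wdensity p e g = wdensity p (relpre h e) g.
Proof.
move=> [k hK kK]; rewrite /wdensity.
rewrite (reindex (fun f : {ffun V' -> T} => [ffun x => f (k x)])) /=; last first.
  exists (fun f : {ffun V -> T} => [ffun x => f (h x)]) => f _; apply/ffunP => x;
  by rewrite !ffunE ?hK ?kK.
apply: eq_big => [f|f _].
  apply/rel_homP/rel_homP => H x y.
    by move=> exy; have := H _ _ exy; rewrite !ffunE !hK.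
  by move=> exy; rewrite !ffunE; apply: H; rewrite /= !kK.
rewrite (reindex h) /=; last by exists k => x _.
by apply: eq_bigr => x _; rewrite ffunE hK.
Qed.

Lemma wdensity_bijr (R : realType) (V T T' : finType) (h : T' -> T)
    (p : T -> R) (e : rel V) (g : rel T) :
  bijective h -> wdensity p e g = wdensity (p \o h) e (relpre h g).
Proof.
move=> [k hK kK]; rewrite /wdensity.
rewrite (reindex (fun f : {ffun V -> T'} => [ffun x => h (f x)])) /=; last first.
  exists (fun f : {ffun V -> T} => [ffun x => k (f x)]) => f _; apply/ffunP => x;
  by rewrite !ffunE ?hK ?kK.
apply: eq_big => [f|f _]; last by apply: eq_bigr => x _; rewrite ffunE.
by apply/rel_homP/rel_homP => H x y exy; have := H _ _ exy; rewrite /= !ffunE.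
Qed.

Definition sum_rel (V1 V2 : finType) (e1 : rel V1) (e2 : rel V2) : rel (V1 + V2) :=
  fun u v => match u, v with
    | inl x, inl y => e1 x y | inr x, inr y => e2 x y | _, _ => false end.

Lemma wdensity_sumV (R : realType) (V1 V2 T : finType) (p : T -> R)
    (e1 : rel V1) (e2 : rel V2) (g : rel T) :
  wdensity p (sum_rel e1 e2) g = wdensity p e1 g * wdensity p e2 g.
Proof.
rewrite /wdensity mulr_suml; under [in RHS]eq_bigr do rewrite mulr_sumr.
rewrite pair_big /=.
pose join (f : {ffun V1 -> T} * {ffun V2 -> T}) : {ffun V1 + V2 -> T} :=
  [ffun u => match u with inl x => f.1 x | inr y => f.2 y end].
rewrite (reindex join) /=; last first.
  exists (fun f : {ffun V1 + V2 -> T} => ([ffun x => f (inl x)], [ffun y => f (inr y)])).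
    by move=> [f1 f2] _; congr (_, _); apply/ffunP => x; rewrite !ffunE.
  by move=> f _; apply/ffunP => -[x|x]; rewrite !ffunE.
apply: eq_big => [[f1 f2]|[f1 f2] _] /=.
  apply/rel_homP/andP => [H|[/rel_homP H1 /rel_homP H2]].
    split; apply/rel_homP => x y exy.
      by have := H (inl x) (inl y) exy; rewrite !ffunE.
    by have := H (inr x) (inr y) exy; rewrite !ffunE.
  by move=> [x|x] [y|y] //= exy; rewrite !ffunE /=; [apply: H1|apply: H2].
rewrite big_sumType; congr (_ * _); apply: eq_bigr => x _; by rewrite ffunE.
Qed.

Lemma connect_homo (V V' : finType) (e : rel V) (e' : rel V') (h : V -> V') :
  (forall x y, e x y -> connect e' (h x) (h y)) ->
  forall x y, connect e x y -> connect e' (h x) (h y).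
Proof.
move=> H x y /connectP [q] ; elim: q x => [|z q IH] x /=; first by move=> _ ->.
by move=> /andP [exz eq] lq; apply: connect_trans (H _ _ exz) (IH _ eq lq).
Qed.

Definition is_inl (A B : Type) (u : A + B) := if u is inl _ then true else false.

Lemma hom_sum_same_side (V T1 T2 : finType) (e : rel V) (g1 : rel T1) (g2 : rel T2)
    (f : {ffun V -> T1 + T2}) : rel_hom e (sum_rel g1 g2) f ->
  forall x y, connect e x y -> is_inl (f x) = is_inl (f y).
Proof.
move=> /rel_homP H x y /connectP [q]; elim: q x => [|z q IH] x /=; first by move=> _ ->.
move=> /andP [exz eq] lq; rewrite -(IH _ eq lq); have := H _ _ exz.
by case: (f x); case: (f z).
Qed.

(** The homomorphisms that stay within the range {t | c t} of an embedding h
    are the homomorphisms into the graph induced on that range. *)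
Lemma wdensity_on_range (R : realType) (V T T1 : finType) (p : T -> R) (h : T1 -> T)
    (e : rel V) (g : rel T) (c : pred T) (k : T -> T1) :
  cancel h k -> (forall t, c t -> h (k t) = t) -> (forall t, c (h t)) ->
  \sum_(f : {ffun V -> T} | rel_hom e g f && [forall x, c (f x)]) \prod_x p (f x)
  = wdensity (p \o h) e (relpre h g).
Proof.
move=> hK kK ch; rewrite /wdensity.
rewrite (reindex_onto (fun f : {ffun V -> T1} => [ffun x => h (f x)])
   (fun f : {ffun V -> T} => [ffun x => k (f x)])) /=; last first.
  by move=> f /andP [_ /forallP cf]; apply/ffunP => x; rewrite !ffunE kK.
apply: eq_big => [f|f _]; last by apply: eq_bigr => x _; rewrite ffunE.
apply/andP/rel_homP => [[/andP [/rel_homP H _] _] x y exy|H].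
  by have := H _ _ exy; rewrite !ffunE.
split; last by apply/eqP/ffunP => x; rewrite !ffunE hK.
apply/andP; split; last by apply/forallP => x; rewrite ffunE.
by apply/rel_homP => x y exy; rewrite !ffunE; apply: H.
Qed.

Lemma wdensity_scale (R : realType) (V T : finType) (a : R) (p : T -> R) (e : rel V) (g : rel T) :
  wdensity (fun t => a * p t) e g = a ^+ #|V| * wdensity p e g.
Proof.
rewrite /wdensity mulr_sumr; apply: eq_bigr => f _.
by rewrite big_split /= prodr_const.
Qed.

Definition sum_weight (R : realType) (T1 T2 : finType) (a : R) (p1 : T1 -> R) (p2 : T2 -> R)
  (u : T1 + T2) : R := match u with inl x => a * p1 x | inr y => (1 - a) * p2 y end.

(** A connected graph maps into one side of a disjoint union, and its k vertices
    contribute the weight of that side to the power k. This is the finite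
    counterpart of the defining equation of a sum of graph limits. *)
Lemma wdensity_sumT (R : realType) (V T1 T2 : finType) (a : R) (p1 : T1 -> R) (p2 : T2 -> R)
    (e : rel V) (g1 : rel T1) (g2 : rel T2) (v0 : V) :
  (forall x y, connect e x y) ->
  wdensity (sum_weight a p1 p2) e (sum_rel g1 g2) =
  a ^+ #|V| * wdensity p1 e g1 + (1 - a) ^+ #|V| * wdensity p2 e g2.
Proof.
move=> cV; rewrite -!wdensity_scale.
rewrite {1}/wdensity (bigID (fun f : {ffun V -> T1 + T2} => is_inl (f v0))) /=.
congr (_ + _).
- have [t0|T1E] := pickP (fun _ : T1 => true).
    move=> _; pose k (u : T1 + T2) := if u is inl x then x else t0.
    rewrite -(@wdensity_on_range _ _ _ _ (sum_weight a p1 p2) inl e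
      (sum_rel g1 g2) (@is_inl _ _) k) //; last by case.
    apply: eq_bigl => f; have [Hf|//] := boolP (rel_hom _ _ _); rewrite /=.
    apply/idP/forallP => [H x|/(_ v0)//].
    by rewrite (hom_sum_same_side Hf (cV x v0)).
  rewrite big1; last by move=> f /andP [_]; case: (f v0) => // t; have := T1E t.
  by rewrite /wdensity big1 // => f _; have := T1E (f v0).
- have [t0|T2E] := pickP (fun _ : T2 => true).
    move=> _; pose k (u : T1 + T2) := if u is inr x then x else t0.
    rewrite -(@wdensity_on_range _ _ _ _ (sum_weight a p1 p2) inr e
      (sum_rel g1 g2) (fun u => ~~ is_inl u) k) //; last by case.
    apply: eq_bigl => f; have [Hf|//] := boolP (rel_hom _ _ _); rewrite /=.
    apply/idP/forallP => [H x|/(_ v0)//].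
    by rewrite (hom_sum_same_side Hf (cV x v0)).
  rewrite big1; last by move=> f /andP [_]; case: (f v0) => // t; have := T2E t.
  by rewrite /wdensity big1 // => f _; have := T2E (f v0).
Qed.

(** The vertex v0 only witnesses that the graph is nonempty. *)
Program Definition sgraph_of (V : finType) (e : rel V) (v0 : V)
    (se : symmetric e) (ie : irreflexive e) : sgraph :=
  @SGraph #|V| (fun i j => e (enum_val i) (enum_val j)) _ _ _.
Next Obligation. by move=> V e v0 se ie; apply/card_gt0P; exists v0. Qed.
Next Obligation. by move=> V e v0 se ie i j; apply: se. Qed.
Next Obligation. by move=> V e v0 se ie i; apply: ie. Qed.

Lemma enum_val_bijT (V : finType) : bijective (@enum_val V (mem V)).
Proof. by exists enum_rank; [exact: enum_valK|exact: enum_rankK]. Qed.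

Lemma wdensity_sgraph_of (R : realType) (V T : finType) (p : T -> R) (e : rel V) (g : rel T)
    (v0 : V) (se : symmetric e) (ie : irreflexive e) :
  wdensity p (@adj (sgraph_of v0 se ie)) g = wdensity p e g.
Proof. exact/esym/wdensity_bijl/enum_val_bijT. Qed.

Lemma sum_rel_sym (V1 V2 : finType) (e1 : rel V1) (e2 : rel V2) :
  symmetric e1 -> symmetric e2 -> symmetric (sum_rel e1 e2).
Proof. by move=> s1 s2 [x|x] [y|y] /=. Qed.

Lemma sum_rel_irr (V1 V2 : finType) (e1 : rel V1) (e2 : rel V2) :
  irreflexive e1 -> irreflexive e2 -> irreflexive (sum_rel e1 e2).
Proof. by move=> s1 s2 [x|x] /=. Qed.

Definition vert0 (F : sgraph) : 'I_(nverts F) := Ordinal (nverts_gt0 F).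

Definition sgraph_double (F : sgraph) : sgraph :=
  sgraph_of (inl (vert0 F)) (sum_rel_sym (@adj_sym F) (@adj_sym F))
    (sum_rel_irr (@adj_irr F) (@adj_irr F)).

Lemma wdensity_double (R : realType) (T : finType) (p : T -> R) (g : rel T) (F : sgraph) :
  wdensity p (@adj (sgraph_double F)) g = wdensity p (@adj F) g ^+ 2.
Proof. by rewrite wdensity_sgraph_of wdensity_sumV expr2. Qed.

(** Identifies the disjoint union of the two sides of a cut with the whole
    vertex set, so that the lemmas on [sum_rel] apply to a graph that no edge
    of which crosses the cut ([relpre_split_join]). *)
Definition split_join (V : finType) (c : pred V) (u : {x | c x} + {x | ~~ c x}) : V :=
  match u with inl x => val x | inr x => val x end.

Lemma split_join_bij (V : finType) (c : pred V) : bijective (@split_join V c).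
Proof.
apply: inj_card_bij => [[[x cx]|[x cx]] [[y cy]|[y cy]] /= E|].
- by congr inl; apply: val_inj.
- by exfalso; move: cy; rewrite -E cx.
- by exfalso; move: cx; rewrite E cy.
- by congr inr; apply: val_inj.
by rewrite card_sum !card_sig cardC.
Qed.

Lemma relpre_split_join (V : finType) (c : pred V) (e : rel V) :
  symmetric e -> (forall x y, e x y -> c x = c y) ->
  relpre (@split_join V c) e =2 sum_rel (relpre val e) (relpre val e).
Proof.
move=> se ec [x|x] [y|y] //=; apply/negP => /ec.
  by rewrite (valP x) (negbTE (valP y)).
by rewrite (valP y) (negbTE (valP x)).
Qed.

(** The two parts are the component of some vertex and its complement. The lemma
    supports inductions on the number of vertices, from connected graphs to
    all graphs. *)
Lemma sgraph_decompose (F : sgraph) : ~ sgraph_connected F ->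
  exists F1 F2 : sgraph, [/\ (nverts F1 < nverts F)%N, (nverts F2 < nverts F)%N &
    forall (R : realType) (T : finType) (p : T -> R) (g : rel T),
      wdensity p (@adj F) g = wdensity p (@adj F1) g * wdensity p (@adj F2) g].
Proof.
move=> /existsNP [x /existsNP [y /negP ncxy]].
pose c : pred 'I_(nverts F) := connect (@adj F) x.
have ec u v : adj u v -> c u = c v.
  move=> euv; apply/idP/idP => H; apply: connect_trans H (connect1 _) => //.
  by rewrite adj_sym.
have cx : c x by rewrite /c connect0.
pose e1 : rel {u | c u} := relpre val (@adj F).
pose e2 : rel {u | ~~ c u} := relpre val (@adj F).
have s1 : symmetric e1 by move=> u v; exact: adj_sym.
have s2 : symmetric e2 by move=> u v; exact: adj_sym.
have i1 : irreflexive e1 by move=> u; exact: adj_irr.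
have i2 : irreflexive e2 by move=> u; exact: adj_irr.
have card12 : (#|{: {u | c u}}| + #|{: {u | ~~ c u}}| = nverts F)%N.
  by rewrite !card_sig cardC card_ord.
have c1 : (0 < #|{: {u | c u}}|)%N by apply/card_gt0P; exists (exist _ x cx).
have c2 : (0 < #|{: {u | ~~ c u}}|)%N by apply/card_gt0P; exists (exist _ y ncxy).
exists (sgraph_of (exist _ x cx) s1 i1), (sgraph_of (exist _ y ncxy) s2 i2).
split=> [||R T p g].
- by rewrite /= -[X in (_ < X)%N]card12 -[X in (X < _)%N]addn0 ltn_add2l.
- by rewrite /= -[X in (_ < X)%N]card12 -[X in (X < _)%N]add0n ltn_add2r.
rewrite !wdensity_sgraph_of -wdensity_sumV (wdensity_bijl _ _ _ (split_join_bij c)).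
by apply: wdensity_eq => //; exact: relpre_split_join (@adj_sym F) ec.
Qed.

(** Multiplicativity holds in the finite graphs that converge to Gam and survives
    in the limit. *)
Lemma tlim_mul (R : realType) (Gam : graph_limit R) (F F1 F2 : sgraph) :
  (forall (T : finType) (p : T -> R) (g : rel T),
      wdensity p (@adj F) g = wdensity p (@adj F1) g * wdensity p (@adj F2) g) ->
  tlim Gam F = tlim Gam F1 * tlim Gam F2.
Proof.
move=> FM; have [G [_ cG]] := tlimP Gam.
rewrite -(cvg_lim (@Rhausdorff R) (cG F)); apply: cvg_lim => //.
rewrite [X in X @ _](_ : _ = fun n => hom_density R F1 (G n) * hom_density R F2 (G n)).
  exact: cvgM.
by apply/funext => n; rewrite !hom_densityE FM.
Qed.

Lemma tlim_double (R : realType) (Gam : graph_limit R) (F : sgraph) :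
  tlim Gam (sgraph_double F) = tlim Gam F ^+ 2.
Proof. by rewrite expr2; apply: tlim_mul => T p g; rewrite wdensity_double expr2. Qed.

(** * Integrals of functions of independent samples *)

Section iid.
Context (R : realType) (d d' : measure_display) (Om : measurableType d)
  (S : measurableType d') (P : probability Om R) (mu : probability S R)
  (X : nat -> Om -> S).
Hypothesis mX : forall i, measurable_fun setT (X i).
Hypothesis lawX : forall i (A : set S), measurable A -> P (X i @^-1` A) = mu A.
Hypothesis indX : mutually_independent P X.

Definition sample (I : seq nat) (w : Om) : (size I).-tuple S :=
  map_tuple (X ^~ w) (in_tuple I).

Lemma measurable_sample I : measurable_fun setT (sample I).
Proof.
apply/measurable_fun_tnthP => i.
rewrite (_ : _ \o _ = X (tnth (in_tuple I) i)); first exact: mX.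
by apply/funext => w; rewrite /= tnth_map.
Qed.

(** The sides of a box are indexed by nat so that boxes of different
    dimensions can be compared without casts. *)
Definition box (k : nat) (A : nat -> set S) : set (k.-tuple S) :=
  [set t | forall i : 'I_k, A i (tnth t i)].
Arguments box : clear implicits.

Lemma boxI k A B : box k A `&` box k B = box k (fun i => A i `&` B i).
Proof.
apply/seteqP; split => t /=; first by move=> [tA tB] i; split.
by move=> tAB; split=> i; have [] := tAB i.
Qed.

Lemma measurable_box k A : (forall i, measurable (A i)) -> measurable (box k A).
Proof.
move=> mA.
rewrite (_ : box k A = \big[setI/setT]_(i < k) ((@tnth k S) ^~ i @^-1` A i)); last first.
  rewrite -bigcap_seq; apply/seteqP; split => t /= H i; first by move=> _; apply: H.
  by apply: H; rewrite /= mem_index_enum.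
apply: bigsetI_measurable => i _; rewrite -[X in measurable X]setTI.
exact: measurable_tnth.
Qed.

Lemma sample_box I A : uniq I -> (forall i, measurable (A i)) ->
  (P (sample I @^-1` box (size I) A) = \prod_(0 <= i < size I) P (X (nth 0%N I i) @^-1` A i))%E.
Proof.
move=> uI mA.
have := indX uI (fun j => mA (index j I)).
rewrite (big_nth 0%N) => H.
rewrite (_ : _ @^-1` _ = \bigcap_(i in [set` I]) X i @^-1` A (index i I)).
  rewrite H; apply: eq_big_nat => i /andP [_ iI].
  by rewrite index_uniq.
apply/seteqP; split => w /= Hw i.
  move=> /= iI; have iS : (index i I < size I)%N by rewrite index_mem.
  by have := Hw (Ordinal iS); rewrite tnth_map (tnth_nth 0%N) /= nth_index.
rewrite tnth_map (tnth_nth 0%N) /=.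
have := Hw (nth 0%N I i); rewrite /= mem_nth // => /(_ isT).
by rewrite index_uniq.
Qed.

(** Mutual independence is a statement about boxes only. Both sides are finite
    measures in B that agree on boxes, and boxes form a pi-system that
    generates the product sigma-algebra. *)
Lemma indep_cons i I (A : set S) (B : set ((size I).-tuple S)) :
  uniq (i :: I) -> measurable A -> measurable B ->
  (P (X i @^-1` A `&` sample I @^-1` B) = mu A * P (sample I @^-1` B))%E.
Proof.
move=> uiI mA mB.
have mXA : measurable (X i @^-1` A) by rewrite -[X in measurable X]setTI; exact: mX.
pose sI : {mfun Om >-> (size I).-tuple S} :=
  HB.pack (sample I) (isMeasurableFun.Build _ _ _ _ (sample I) (@measurable_sample I)).
have muA_fin : mu A \is a fin_num by exact: fin_num_measure.
have muA0 : 0 <= fine (mu A) by apply: fine_ge0.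
pose pf : {measure set ((size I).-tuple S) -> \bar R} :=
  pushforward (mrestr P mXA) sI.
pose m1 := pf (@measurable_sample I).
pose m2 : {measure set ((size I).-tuple S) -> \bar R} := mscale (NngNum muA0) (distribution P sI).
have m12 : m1 B = m2 B.
  pose C := [set E | exists2 F : nat -> set S, (forall j, measurable (F j)) & E = box (size I) F].
  apply: (g_sigma_algebra_measure_unique C _ (fun=> setT)).
  - by move=> E [F mF ->]; exact: measurable_box.
  - move=> _; exists (fun=> setT) => //; by apply/seteqP; split.
  - by apply/seteqP; split => // t _; exists 0%N.
  - by move=> E1 E2 [F1 mF1 ->] [F2 mF2 ->]; exists (fun j => F1 j `&` F2 j); rewrite ?boxI // => j;
      exact: measurableI.
  - move=> E [F mF ->].
    rewrite /m1 /pf /m2 /= /pushforward /mrestr /mscale /= /distribution /pushforward /= fineK //.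
    have uI : uniq I by case/andP: uiI.
    have mAF j : measurable (if j is j'.+1 then F j' else A) by case: j.
    have := sample_box uiI mAF.
    rewrite big_nat_recl //= lawX // -(sample_box uI mF) => <-; congr (P _).
    apply/seteqP; split => w /=.
      by move=> [Fw Aw] [[|j] jI] //=; rewrite (tnth_nth (X 0%N w)) //=;
        have := Fw (Ordinal (jI : (j < size I)%N)); rewrite (tnth_nth (X 0%N w)).
    move=> Hw; split; last by have := Hw ord0.
    by move=> j; have := Hw (lift ord0 j); rewrite !(tnth_nth (X 0%N w)).
  - move=> k; rewrite /= /m1 /pf /pushforward /mrestr /= preimage_setT setTI.
    by apply: (le_lt_trans (probability_le1 P mXA)); rewrite ltry.
  - move: B mB; apply: smallest_sub; first exact: smallest_sigma_algebra.
    move=> E; rewrite -bigcup_seq => -[j _ [F mF <-]]; apply: sub_sigma_algebra.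
    exists (fun n : nat => if n == j :> nat then F else setT); first by move=> n; case: ifP.
    rewrite setTI; apply/seteqP; split => t /=.
      move=> Ft n; have [E'|] := eqVneq (n : nat) j => //.
      by rewrite (val_inj E').
    by move=> /(_ j); rewrite eqxx.
move: m12; rewrite /m1 /pf /m2 /= /pushforward /mrestr /mscale /= /distribution /pushforward /= fineK //.
by rewrite setIC.
Qed.

(** By [indep_cons] the law of the sample is the product of the law of its head
    and the law of its tail; Tonelli's theorem then peels off the outermost of
    the iterated integrals. *)
Lemma integral_sample (I : seq nat) (f : (size I).-tuple S -> \bar R) : uniq I ->
  measurable_fun [set: (size I).-tuple S] f -> (forall t, 0 <= f t)%E ->
  (\int[P]_w f (sample I w) = iter_integral mu f)%E.
Proof.
elim: I f => [|i I IH] f uiI mf f0.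
  rewrite /= (eq_integral (cst (f [tuple]))); last first.
    by move=> w _; rewrite [sample _ _]tuple0.
  by rewrite integral_cst // -[RHS]mule1; congr (_ * _)%E; exact: probability_setT.
have uI : uniq I by case/andP: uiI.
pose h (z : S * (size I).-tuple S) : (size I).+1.-tuple S := [tuple of z.1 :: z.2].
have mh : measurable_fun setT h by apply: measurable_cons.
pose Y w := (X i w, sample I w).
have mY : measurable_fun setT Y.
  by apply/measurable_fun_pairP; split; [exact: mX|exact: measurable_sample].
pose sI : {mfun Om >-> (size I).-tuple S} :=
  HB.pack (sample I) (isMeasurableFun.Build _ _ _ _ (sample I) (@measurable_sample I)).
pose Yp : {mfun Om >-> (S * (size I).-tuple S)%type} :=
  HB.pack Y (isMeasurableFun.Build _ _ _ _ Y mY).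
have mfh : measurable_fun setT (f \o h) by exact: measurableT_comp.
transitivity (\int[P]_w ((f \o h) \o Yp) w)%E.
  by apply: eq_integral => w _; congr f; apply: val_inj.
rewrite -(ge0_integral_distribution Yp mfh); last by move=> z; exact: f0.
rewrite (eq_measure_integral (mu \x distribution P sI)%E); last first.
  move=> A mA _; apply/esym; apply: product_measure_unique => // B C mB mC.
  by rewrite -(indep_cons uiI mB mC).
rewrite fubini_tonelli1 //; last by move=> z; exact: f0.
rewrite /=; apply: eq_integral => x _; rewrite /fubini_F.
have mfx : measurable_fun setT (fun t : (size I).-tuple S => f [tuple of x :: t]).
  by apply: measurableT_comp => //; apply: measurable_cons.
have fx0 (t : (size I).-tuple S) : (0 <= f [tuple of x :: t])%E by exact: f0.
rewrite -(IH _ uI mfx fx0).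
by rewrite -(ge0_integral_distribution sI mfx fx0).
Qed.

Lemma integral_sample_tuple k (I : k.-tuple nat) (f : k.-tuple S -> \bar R) : uniq I ->
  measurable_fun [set: k.-tuple S] f -> (forall t, 0 <= f t)%E ->
  (\int[P]_w f (map_tuple (X ^~ w) I) = iter_integral mu f)%E.
Proof.
case: I => s ss; move/eqP: (ss) => E; subst k.
rewrite (bool_irrelevance ss (eqxx _)); exact: integral_sample.
Qed.

End iid.

(** * Laws of random edge sets *)

Definition code_rel (V : finType) (K : {set V * V}) : rel V := fun x y => (x, y) \in K.

Definition loopless (V : finType) (J : {set V * V}) := [forall x, (x, x) \notin J].

(** Symmetrising and removing the loops makes every set of pairs a graph, so
    that functions of a random graph are plain functions of a random set. *)
Program Definition edge_graph (n : nat) (J : {set 'I_n.+1 * 'I_n.+1}) : sgraph :=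
  @SGraph n.+1 (fun x y => (x != y) && (((x, y) \in J) || ((y, x) \in J))) _ _ _.
Next Obligation. by []. Qed.
Next Obligation. by move=> n J x y; rewrite eq_sym orbC. Qed.
Next Obligation. by move=> n J x; rewrite eqxx. Qed.

Lemma edge_graph_sub (n : nat) (J : {set 'I_n.+1 * 'I_n.+1}) (r : rel 'I_n.+1) :
  loopless J -> symmetric r ->
  (forall x y, @adj (edge_graph J) x y -> r x y) <-> J \subset [set p | r p.1 p.2]%SET.
Proof.
move=> /forallP lJ sr; split=> [H|/fintype.subsetP H x y /= /andP [_ /orP [] /H]]; last 2 first.
- by rewrite inE.
- by rewrite inE /= sr.
apply/fintype.subsetP => -[x y] xyJ; rewrite inE; apply: H => /=; rewrite xyJ /= andbT.
by apply/eqP => E; move: (lJ x); rewrite {2}E xyJ.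
Qed.

Lemma cvg_sumr (R : realType) (I : finType) (Q : pred I) (T : Type) (F : set_system T)
    (f : I -> T -> R) (l : I -> R) : Filter F ->
  (forall i, Q i -> f i x @[x --> F] --> l i) ->
  \sum_(i | Q i) f i x @[x --> F] --> \sum_(i | Q i) l i.
Proof. by move=> FF H; apply: cvg_big => //; exact: add_continuous. Qed.

(** Continuous Moebius inversion: a function on the subsets of a finite set is
    recovered from its sums over the up-sets {K | J \subset K} by downward
    induction on J, and each step of this recovery is continuous. *)
Lemma upsum_cvg (R : realType) (T : finType) (f : nat -> {set T} -> R) (g : {set T} -> R) :
  (forall J : {set T}, \sum_(K : {set T} | J \subset K) f m K @[m --> \oo]
     --> \sum_(K : {set T} | J \subset K) g K) ->
  forall J, f m J @[m --> \oo] --> g J.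
Proof.
move=> H J; have [n] := ubnP #|~: J|; elim: n J => // n IH J; rewrite ltnS => Jn.
have E (h : {set T} -> R) : h J =
    \sum_(K : {set T} | J \subset K) h K - \sum_(K : {set T} | J \proper K) h K.
  apply/eqP; rewrite eq_sym subr_eq eq_sym [X in _ == X](bigD1 J) //=.
  by apply/eqP; congr (_ + _); apply: eq_bigl => K; rewrite finset.properEneq andbC eq_sym.
rewrite (E g) (_ : (fun m => f m J) = fun m => \sum_(K : {set T} | J \subset K) f m K -
    \sum_(K : {set T} | J \proper K) f m K); last by apply/funext => m; exact: E.
apply: cvgB; first exact: H.
apply: cvg_sumr => K JK; apply: IH; apply: leq_trans Jn.
by apply: proper_card; rewrite finset.properC.
Qed.

Lemma upsum_inj (R : realType) (T : finType) (f g : {set T} -> R) :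
  (forall J : {set T}, \sum_(K : {set T} | J \subset K) f K = \sum_(K : {set T} | J \subset K) g K) ->
  f =1 g.
Proof.
move=> H K; have := @upsum_cvg R T (fun=> f) g _ K.
move=> /(_ (fun J => _)) C; rewrite -(cvg_lim (@Rhausdorff R) (C _)).
  by rewrite lim_cst //; exact: Rhausdorff.
by move=> J; rewrite H; exact: cvg_cst.
Qed.

Section subgraph_probability.
Context (R : realType) (d : measure_display) (Om : measurableType d)
  (P : probability Om R) (Gam : graph_limit R) (G : Om -> rel nat).
Hypothesis hG : is_G_infty P Gam G.

Definition edge_code (k : nat) (phi : 'I_k -> nat) (w : Om) : {set 'I_k * 'I_k} :=
  [set p | G w (phi p.1) (phi p.2)].

Lemma measurable_edge_code_eq (k : nat) (phi : 'I_k -> nat) (K : {set 'I_k * 'I_k}) :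
  measurable [set w | edge_code phi w = K].
Proof.
have mG : forall i j, measurable [set w | G w i j] by case: hG.
rewrite (_ : [set w | _] = \big[setI/setT]_p
   (if p \in K then [set w | G w (phi p.1) (phi p.2)]
    else ~` [set w | G w (phi p.1) (phi p.2)])).
  apply: bigsetI_measurable => p _; case: ifP => _; first exact: mG.
  by apply: measurableC; exact: mG.
rewrite -bigcap_seq; apply/seteqP; split => w /= H.
  by move=> p _; rewrite -H inE; case: ifP => //= ->.
apply/setP => p; rewrite inE; have := H p; rewrite /= mem_index_enum => /(_ isT).
by case: (p \in K) => //=; move/negP/negbTE.
Qed.

Lemma measurable_event (k : nat) (psi : 'I_k -> nat) (E : pred {set 'I_k * 'I_k}) :
  measurable [set w | E (edge_code psi w)].
Proof.
rewrite (_ : [set w | _] = \big[setU/set0]_(K | E K) [set w | edge_code psi w = K]).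
  by apply: bigsetU_measurable => K _; exact: measurable_edge_code_eq.
rewrite -bigcup_pred; apply/seteqP; split => w /=; first by move=> H; exists (edge_code psi w).
by move=> [K /= H E']; rewrite E'.
Qed.

(** The conditional independence of the edges gives the probability as the
    expectation of the product of the values of W, and [integral_sample_tuple]
    turns it into the iterated integral that represents t(F, Gam). *)
Lemma prob_subgraph (F : sgraph) (phi : 'I_(nverts F) -> nat) : injective phi ->
  P [set w | forall x y, adj x y -> G w (phi x) (phi y)] = (tlim Gam F)%:E.
Proof.
move=> phi_inj.
case: hG => symG irrG mG [d' [S [mu [W [X [[[symW mW W01] repW] mX lawX indX cie]]]]]].
rewrite repW.
pose I := [tuple phi i | i < nverts F].
have uI : uniq I by rewrite /= map_inj_uniq ?enum_uniq.
pose Q : pred ('I_(nverts F) * 'I_(nverts F)) := fun p => (p.1 < p.2)%N && adj p.1 p.2.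
(* phi need not be increasing, while conditional independence is stated for
   pairs in increasing order. *)
pose ord (p : 'I_(nverts F) * 'I_(nverts F)) : nat * nat :=
  if (phi p.1 < phi p.2)%N then (phi p.1, phi p.2) else (phi p.2, phi p.1).
pose ps := [seq p <- index_enum ('I_(nverts F) * 'I_(nverts F))%type | Q p].
pose E := [seq ord p | p <- ps].
have ups : uniq ps by rewrite filter_uniq // index_enum_uniq.
have ord_inj : {in ps &, injective ord}.
  move=> p q; case: p => a b; case: q => a' b'; rewrite !mem_filter /Q /=.
  move=> /andP [/andP [ab _] _] /andP [/andP [ab' _] _].
  rewrite /ord /=; case: ifP => _; case: ifP => _ [] /phi_inj e1 /phi_inj e2; rewrite ?e1 ?e2 //.
    by move: ab; rewrite e1 e2 ltnNge (ltnW ab').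
  by move: ab; rewrite e1 e2 ltnNge (ltnW ab').
have uE : uniq E by rewrite map_inj_in_uniq.
have oE : all (fun e => e.1 < e.2)%N E.
  apply/allP => e /mapP [[a b] + ->]; rewrite mem_filter => /andP [/andP [/= ab _] _].
  rewrite /ord /=; case: ifP => //= /negbT; rewrite -leqNgt leq_eqVlt.
  by case/orP => [/eqP /phi_inj E'|//]; move: ab; rewrite E' ltnn.
rewrite (_ : [set w | _] = setT `&` [set w | all (fun e => G w e.1 e.2) E]); last first.
  rewrite setTI; apply/seteqP; split => w /= H.
    apply/allP => e /mapP [[a b] + ->]; rewrite mem_filter => /andP [/andP [/= ab adjab] _].
    by rewrite /ord /=; case: ifP => _ /=; [|rewrite symG]; exact: H.
  have H' (a b : 'I_(nverts F)) : (a < b)%N -> adj a b -> G w (phi a) (phi b).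
    move=> ab adjab; have abE : ord (a, b) \in E.
      by apply: map_f; rewrite mem_filter /Q /= ab adjab mem_index_enum.
    by have := allP H _ abE; rewrite /ord /=; case: ifP => _ //=; rewrite symG.
  move=> x y adjxy; case: (ltngtP x y) => [xy|yx|/val_inj xy].
  - exact: H'.
  - by rewrite symG; apply: H' => //; rewrite adj_sym.
  - by move: adjxy; rewrite xy adj_irr.
rewrite (cie E uE oE setT); last first.
  rewrite /sigma_generated; set C := [set B | _].
  by have := sigma_algebraCD (@sigma_algebra0 _ setT C); rewrite setD0.
pose f (t : (nverts F).-tuple S) : R := \prod_(p | Q p) W (tnth t p.1) (tnth t p.2).
have mtn : forall i : 'I_(nverts F), measurable_fun setT (fun t : (nverts F).-tuple S => tnth t i).
  by move=> i; exact: measurable_tnth.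
have mf : measurable_fun setT f.
  rewrite (_ : f = fun t => \prod_(p <- ps) W (tnth t p.1) (tnth t p.2)); last first.
    by apply/funext => t; rewrite /f /ps big_filter.
  apply: measurable_prod => p _.
  have mp : measurable_fun setT (fun t : (nverts F).-tuple S => (tnth t p.1, tnth t p.2)).
    by apply/measurable_fun_pairP; split; exact: mtn.
  exact: measurableT_comp mW mp.
rewrite -(integral_sample_tuple mX lawX indX (f := fun t => (f t)%:E) uI) //; last first.
- by move=> t; rewrite lee_fin; apply: prodr_ge0 => p _; case/andP: (W01 (tnth t p.1) (tnth t p.2)).
- exact/measurable_EFinP.
apply: eq_integral => w _; congr EFin.
rewrite /f /E big_map /ps big_filter; apply: eq_bigr => -[a b] _.
rewrite !tnth_map !tnth_ord_tuple /ord /=; case: ifP => //= _.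
Qed.

Definition graph_law (k : nat) (phi : 'I_k -> nat) (K : {set 'I_k * 'I_k}) : R :=
  fine (P [set w | edge_code phi w = K]).

Lemma graph_law_ge0 (k : nat) (phi : 'I_k -> nat) K : 0 <= graph_law phi K.
Proof. exact: fine_ge0. Qed.

Lemma graph_law_event (k : nat) (phi : 'I_k -> nat) (E : pred {set 'I_k * 'I_k}) :
  P [set w | E (edge_code phi w)] = (\sum_(K | E K) graph_law phi K)%:E.
Proof.
pose A K := [set w | edge_code phi w = K /\ E K].
have AE K : A K = if E K then [set w | edge_code phi w = K] else set0.
  by apply/seteqP; split => w; rewrite /A /=; case: ifP => //= EK; case.
have mA K : measurable (A K).
  by rewrite AE; case: ifP => _; [exact: measurable_edge_code_eq|exact: measurable0].
rewrite (_ : [set w | _] = \bigcup_(K in [set` index_enum {set 'I_k * 'I_k}]) A K); last first.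
  apply/seteqP; split => w /=; first by move=> Ew; exists (edge_code phi w); rewrite //= mem_index_enum.
  by move=> [K _ [->]].
rewrite measure_fin_bigcup //; last first.
  by move=> K L _ _ [w [[<- _] [<- _]]].
rewrite -fsbig_seq ?index_enum_uniq // -sumEFin [RHS]big_mkcond; apply: eq_bigr => K _.
rewrite AE; case: ifP => _; last exact: measure0.
by rewrite /graph_law fineK // fin_num_measure //; exact: measurable_edge_code_eq.
Qed.

Lemma upsum_graph_law (n : nat) (phi : 'I_n.+1 -> nat) (J : {set 'I_n.+1 * 'I_n.+1}) :
  injective phi ->
  \sum_(K : {set 'I_n.+1 * 'I_n.+1} | J \subset K) graph_law phi K =
  if loopless J then tlim Gam (edge_graph J) else 0.
Proof.
move=> phi_inj; apply: EFin_inj; rewrite -(graph_law_event phi (fun K => J \subset K)).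
have [symG irrG _ _] := hG.
case: ifPn => [lJ|/forallPn [x]].
  rewrite -(@prob_subgraph (edge_graph J) phi phi_inj); congr (P _).
  have sr w : symmetric (fun x y => G w (phi x) (phi y)) by move=> x y; exact: symG.
  apply/eq_set => w; apply/propext; have [e1 e2] := edge_graph_sub lJ (sr w).
  split=> /= H; [exact (e2 H)|exact (e1 H)].
rewrite negbK => xJ; rewrite [X in P X](_ : _ = set0) ?measure0 //.
by apply/seteqP; split => w //= /fintype.subsetP /(_ _ xJ); rewrite inE irrG.
Qed.

(** The up-set sums of the law depend on the edge set alone, not on the
    vertices where it is placed. *)
Lemma graph_law_exchangeable (n : nat) (phi psi : 'I_n.+1 -> nat) :
  injective phi -> injective psi -> graph_law phi =1 graph_law psi.
Proof.
by move=> phi_inj psi_inj; apply: upsum_inj => J; rewrite !upsum_graph_law.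
Qed.

End subgraph_probability.

(** * Disconnected limits *)

Section weighted_sample.
Context (R : realType) (n : nat) (T : finType) (p : T -> R) (g : rel T).

Definition pullback_code (f : {ffun 'I_n.+1 -> T}) : {set 'I_n.+1 * 'I_n.+1} :=
  [set u | g (f u.1) (f u.2)].

(** The law of the graph on n.+1 vertices pulled back from g along n.+1
    independent vertices of law p. *)
Definition sample_law (K : {set 'I_n.+1 * 'I_n.+1}) : R :=
  \sum_(f | pullback_code f == K) \prod_x p (f x).

Lemma sample_law_event (E : pred {set 'I_n.+1 * 'I_n.+1}) :
  \sum_(K | E K) sample_law K = \sum_(f | E (pullback_code f)) \prod_x p (f x).
Proof.
rewrite (partition_big pullback_code E) //=; apply: eq_bigr => K EK; apply: eq_bigl => f.
by case: eqP => [->|]; rewrite ?EK ?andbF.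
Qed.

Lemma upsum_sample_law (J : {set 'I_n.+1 * 'I_n.+1}) : symmetric g -> irreflexive g ->
  \sum_(K : {set 'I_n.+1 * 'I_n.+1} | J \subset K) sample_law K =
  if loopless J then wdensity p (@adj (edge_graph J)) g else 0.
Proof.
move=> sg ig; rewrite (sample_law_event (fun K => J \subset K)); case: ifPn => [lJ|].
  apply: eq_bigl => f.
  have sf : symmetric (fun x y => g (f x) (f y)) by move=> x y; exact: sg.
  by apply/idP/rel_homP; have [e1 e2] := edge_graph_sub lJ sf.
move=> /forallPn [x]; rewrite negbK => xJ; apply: big_pred0 => f.
by apply/negP => /fintype.subsetP /(_ _ xJ); rewrite inE ig.
Qed.

End weighted_sample.

Lemma sum_weight_ge0 (R : realType) (T1 T2 : finType) (a : R) (p1 : T1 -> R) (p2 : T2 -> R) :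
  0 <= a <= 1 -> (forall t, 0 <= p1 t) -> (forall t, 0 <= p2 t) ->
  forall t, 0 <= sum_weight a p1 p2 t.
Proof.
move=> /andP [a0 a1] p10 p20 [t|t] /=; first exact: mulr_ge0.
by rewrite mulr_ge0 // subr_ge0.
Qed.

(** The parts from which the vertices are drawn are independent, with
    probabilities a and 1 - a; the event is that the first j of them agree. *)
Lemma two_color_bound (R : realType) (n j : nat) (T1 T2 : finType) (a : R)
    (p1 : T1 -> R) (p2 : T2 -> R) :
  (j <= n.+1)%N -> 0 <= a <= 1 -> (forall t, 0 <= p1 t) -> (forall t, 0 <= p2 t) ->
  \sum_t p1 t = 1 -> \sum_t p2 t = 1 ->
  \sum_(f : {ffun 'I_n.+1 -> T1 + T2} |
      [forall i : 'I_n.+1, (i < j)%N ==> (is_inl (f ord0) == is_inl (f i))])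
    \prod_x sum_weight a p1 p2 (f x) <= a ^+ j + (1 - a) ^+ j.
Proof.
move=> jn a01 p10 p20 s1 s2; set p := sum_weight a p1 p2.
have p0 : forall t, 0 <= p t by exact: sum_weight_ge0.
have mono b : \sum_(f : {ffun 'I_n.+1 -> T1 + T2} |
     [forall i : 'I_n.+1, (i < j)%N ==> (b == is_inl (f i))]) \prod_x p (f x)
  = (if b then a else 1 - a) ^+ j.
  transitivity (\prod_(i < n.+1) \sum_(t | (i < j)%N ==> (b == is_inl t)) p t).
    by rewrite bigA_distr_big_dep; apply: eq_bigl => f.
  transitivity (\prod_(i < n.+1) if (i < j)%N then (if b then a else 1 - a) else 1).
    apply: eq_bigr => i _; rewrite big_mkcond big_sumType /=.
    case: ltnP => _ /=.
      case: (b); rewrite /= -!mulr_sumr ?s1 ?s2 ?mulr1.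
        by rewrite [X in _ + X]big1 ?addr0.
      by rewrite [X in X + _]big1 ?add0r.
    by rewrite -!mulr_sumr s1 s2 !mulr1 addrC subrK.
  rewrite -big_mkcond /= (big_ord_narrow jn) /=.
  by rewrite prodr_const card_ord.
rewrite -(mono true) -(mono false) [leLHS](bigID (fun f : {ffun 'I_n.+1 -> T1 + T2} => is_inl (f ord0))) /=.
apply: lerD; rewrite big_mkcond [leRHS]big_mkcond; apply: ler_sum => f _;
  rewrite andbC; case: (is_inl (f ord0)) => //=; case: ifP => _ //; exact: prodr_ge0.
Qed.

Lemma sum_uniform (R : realType) (G : sgraph) :
  \sum_(t : 'I_(nverts G)) (nverts G)%:R^-1 = 1 :> R.
Proof.
by rewrite sumr_const card_ord -[LHS]mulr_natl divff // pnatr_eq0 -lt0n nverts_gt0.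
Qed.

Lemma cvgrX (R : realType) (T : Type) (F : set_system T) (f : T -> R) (l : R) (n : nat) :
  Filter F -> f x @[x --> F] --> l -> f x ^+ n @[x --> F] --> l ^+ n.
Proof.
move=> FF fl; elim: n => [|n IH]; first by under eq_fun do rewrite expr0; exact: cvg_cst.
under eq_fun do rewrite exprS.
by rewrite exprS; exact: cvgM.
Qed.

(** The definition of the sum of graph limits covers connected F only; both
    sides are multiplicative over disjoint unions. *)
Lemma mixture_cvg (R : realType) (a : R) (Gam1 Gam2 Gam : graph_limit R) (G1 G2 : nat -> sgraph) :
  is_limit_sum a Gam1 Gam2 Gam ->
  (forall F, hom_density R F (G1 n) @[n --> \oo] --> tlim Gam1 F) ->
  (forall F, hom_density R F (G2 n) @[n --> \oo] --> tlim Gam2 F) ->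
  forall F, wdensity (sum_weight a (fun=> (nverts (G1 n))%:R^-1) (fun=> (nverts (G2 n))%:R^-1))
      (@adj F) (sum_rel (@adj (G1 n)) (@adj (G2 n))) @[n --> \oo] --> tlim Gam F.
Proof.
move=> ms c1 c2 F; have [k] := ubnP (nverts F); elim: k F => // k IH F; rewrite ltnS => Fk.
have [cF|/sgraph_decompose [F1 [F2 [n1 n2 FM]]]] := pselect (sgraph_connected F).
  rewrite (ms _ cF); under eq_fun do rewrite (wdensity_sumT _ _ _ _ _ (vert0 F) cF) -!hom_densityE card_ord.
  by apply: cvgD; (apply: cvgM; [exact: cvg_cst|]).
rewrite (tlim_mul _ (FM R)); under eq_fun do rewrite FM.
by apply: cvgM; apply: IH; [exact: leq_trans n1 Fk|exact: leq_trans n2 Fk].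
Qed.

Definition conn_upto (n j : nat) (K : {set 'I_n.+1 * 'I_n.+1}) :=
  [forall i : 'I_n.+1, (i < j)%N ==> connect (code_rel K) ord0 i].

Lemma path_connect (e : rel nat) (n : nat) (x : 'I_n.+1) (s : seq nat) :
  path e x s -> all (fun i => i < n.+1)%N s ->
  exists2 y : 'I_n.+1, y = last (val x) s :> nat & connect (fun a b : 'I_n.+1 => e a b) x y.
Proof.
elim: s x => [|z s IH] x /=; first by exists x.
move=> /andP [exz es] /andP [zn sn].
have [y yE cy] := IH (Ordinal zn) es sn; exists y => //.
by apply: connect_trans cy; exact: connect1.
Qed.

Section disconnected_case.
Context (R : realType) (d : measure_display) (Om : measurableType d)
  (P : probability Om R) (Gam : graph_limit R) (G : Om -> rel nat).
Hypothesis hG : is_G_infty P Gam G.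

Let incl n : 'I_n.+1 -> nat := @nat_of_ord n.+1.

(** The bound does not depend on n: it holds for samples from the weighted
    disjoint unions, because a path cannot leave the part where it starts, and
    passes to the limit in law. *)
Lemma conn_upto_prob (Gam1 Gam2 : graph_limit R) (a : R) (n j : nat) :
  0 < a < 1 -> is_limit_sum a Gam1 Gam2 Gam -> (j <= n.+1)%N ->
  (P [set w | conn_upto j (edge_code G (@incl n) w)] <= (a ^+ j + (1 - a) ^+ j)%:E)%E.
Proof.
move=> a01 ms jn; rewrite (graph_law_event hG) lee_fin.
have [G1 [_ c1]] := tlimP Gam1; have [G2 [_ c2]] := tlimP Gam2.
pose p m : 'I_(nverts (G1 m)) + 'I_(nverts (G2 m)) -> R :=
  sum_weight a (fun=> (nverts (G1 m))%:R^-1) (fun=> (nverts (G2 m))%:R^-1).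
pose g m := sum_rel (@adj (G1 m)) (@adj (G2 m)).
have cv : (\sum_(K | conn_upto j K) sample_law (n := n) (p m) (g m) K) @[m --> \oo] -->
    \sum_(K | conn_upto j K) graph_law P G (@incl n) K.
  apply: cvg_sumr => K _.
  apply: (@upsum_cvg R _ (fun m => sample_law (p m) (g m)) (graph_law P G (@incl n))) => J.
  rewrite (upsum_graph_law hG) //; last exact: val_inj.
  rewrite (_ : (fun m => _) = fun m =>
      if loopless J then wdensity (p m) (@adj (edge_graph J)) (g m) else 0); last first.
    apply/funext => m; apply: upsum_sample_law.
      by apply: sum_rel_sym; exact: adj_sym.
    by apply: sum_rel_irr; exact: adj_irr.
  case: ifP => _; last exact: cvg_cst.
  exact: mixture_cvg ms c1 c2 (edge_graph J).
apply: (cvgr_to_le cv); apply: nearW => m.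
rewrite sample_law_event.
have a01' : 0 <= a <= 1 by case/andP: a01 => /ltW -> /ltW ->.
have u0 (H : sgraph) (t : 'I_(nverts H)) : 0 <= (nverts H)%:R^-1 :> R by rewrite invr_ge0.
apply: le_trans (two_color_bound jn a01' (@u0 (G1 m)) (@u0 (G2 m)) (sum_uniform _ _) (sum_uniform _ _)).
rewrite big_mkcond [leRHS]big_mkcond; apply: ler_sum => f _.
have f0 : 0 <= \prod_x p m (f x) by apply: prodr_ge0 => x _; apply: sum_weight_ge0.
case: ifP => [/forallP H|_]; last by case: ifP.
rewrite ifT //; apply/forallP => i; apply/implyP => ij.
have /implyP /(_ ij) ci := H i.
have hf : rel_hom (code_rel (pullback_code (g m) f)) (sum_rel (@adj (G1 m)) (@adj (G2 m))) f.
  by apply/rel_homP => x y; rewrite /code_rel inE.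
apply/eqP; exact: (hom_sum_same_side hf ci).
Qed.

(** If G is connected, then for each j some finite restriction of G joins the
    first j vertices. These events increase with the size of the restriction,
    so their union has probability at most a^j + (1-a)^j. *)
Lemma disconnected_ae : limit_disconnected Gam -> {ae P, forall w, ~ igraph_connected (G w)}.
Proof.
move=> [Gam1 [Gam2 [a [a01 ms]]]].
pose A j N := [set w | conn_upto j (edge_code G (@incl (j + N)) w)].
have mA j N : measurable (A j N).
  exact: (measurable_event hG (@incl (j + N)) (fun K => conn_upto j K)).
(* With j + N + 1 vertices the first j ones are always present; with fewer than
   j vertices conn_upto would speak of the present ones only, and monotonicity
   would fail. *)
have ndA j : nondecreasing_seq (A j).
  move=> N M NM; apply/subsetPset => w /forallP H; apply/forallP => i; apply/implyP => ij.
  have iN : (i < (j + N).+1)%N by apply: leq_trans ij _; rewrite leqW // leq_addr.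
  have := H (Ordinal iN); rewrite /= ij /= => c.
  have le : ((j + N).+1 <= (j + M).+1)%N by rewrite ltnS leq_add2l.
  have := @connect_homo _ _ (code_rel (edge_code G (@incl (j + N)) w)) (code_rel (edge_code G (@incl (j + M)) w))
    (widen_ord le) _ _ _ c.
  rewrite (_ : widen_ord le ord0 = ord0); last exact: val_inj.
  rewrite (_ : widen_ord le _ = i); last exact: val_inj.
  by apply => x y; rewrite /code_rel !inE /= => Gxy; apply: connect1; rewrite inE.
have PA j : (P (\bigcup_N A j N) <= (a ^+ j + (1 - a) ^+ j)%:E)%E.
  have cv := nondecreasing_cvg_mu (mA j) (bigcup_measurable (fun N _ => mA j N)) (ndA j) (mu := P).
  apply: (cvge_to_le cv); apply: nearW => N.
  by apply: (conn_upto_prob a01 ms); rewrite leqW // leq_addr.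
pose B := \bigcap_j \bigcup_N A j N.
have mB : measurable B by apply: bigcapT_measurable => j; apply: bigcupT_measurable => N; exact: mA.
have PB0 : P B = 0%E.
  apply/eqP; rewrite eq_le measure_ge0 andbT.
  have PBj j : (P B <= (a ^+ j + (1 - a) ^+ j)%:E)%E.
    apply: le_trans (PA j); apply: le_measure; [exact/mem_set|apply/mem_set|].
      by apply: bigcupT_measurable => N; exact: mA.
    by move=> w; apply.
  have cv : (a ^+ j + (1 - a) ^+ j)%:E @[j --> \oo] --> 0%:E.
    apply: cvg_EFin; first by apply: nearW.
    rewrite -[X in _ --> X](addr0 (0 : R)); apply: cvgD; apply: cvg_expr.
      by case/andP: a01 => a0 a1; rewrite ger0_norm // ltW.
    by case/andP: a01 => a0 a1; rewrite ger0_norm ?subr_ge0 ?ltW // gtrBl.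
  by apply: (cvge_to_ge cv); apply: nearW.
exists B; split => // w /= /contrapT cw j _.
have [s Hs] : {s : nat -> seq nat & forall i, path (G w) 0%N (s i) /\ last 0%N (s i) = i}.
  apply: (@choice _ _ (fun i s => path (G w) 0%N s /\ last 0%N s = i)) => i.
  by have [q pq lq] := cw 0%N i; exists q.
exists (\max_(i < j) \max_(v <- s i) v)%N => //.
apply/forallP => i; apply/implyP => ij; have [pi li] := Hs i.
have [||y yE cy] := @path_connect (G w) (j + \max_(i < j) \max_(v <- s i) v)%N ord0 (s i).
- exact: pi.
- apply/allP => v vs; rewrite ltnS; apply: leq_trans (leq_addl _ _).
  apply: leq_trans (leq_bigmax (Ordinal ij)) => /=.
  exact: leq_bigmax_seq.
move: yE; rewrite /= li => /val_inj yE; rewrite -yE.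
apply: connect_sub cy => u v Guv; apply: connect1.
by rewrite /code_rel inE.
Qed.

End disconnected_case.

(** * Cutting a graph along its components *)

(** Changing the colour of a exchanges the colourings that separate a from b
    with the others. *)
Lemma card_differ (V : finType) (a b : V) : a != b ->
  (2 * #|[set c : {ffun V -> bool} | c a != c b]%SET| = #|{: {ffun V -> bool}}|)%N.
Proof.
move=> ab; pose flip (c : {ffun V -> bool}) := [ffun x => if x == a then ~~ c x else c x].
have flipK : involutive flip.
  by move=> c; apply/ffunP => x; rewrite !ffunE; case: (x == a); rewrite ?negbK.
have E : #|[set c : {ffun V -> bool} | c a != c b]%SET| = #|~: [set c : {ffun V -> bool} | c a != c b]%SET|.
  rewrite -(card_imset _ (inv_inj flipK)); apply: eq_card => c.
  rewrite -[in LHS](flipK c) mem_imset; last exact: inv_inj.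
  by rewrite !inE !ffunE eqxx [b == a]eq_sym (negbTE ab) negbK; case: (c a); case: (c b).
by rewrite mul2n -addnn {2}E cardsC.
Qed.

(** Colour the components independently by fair coins. A pair in different
    components is separated with probability 1/2, so some colouring separates
    at least half of these ordered pairs; it separates 2 |A| |A^c| ordered
    pairs, where A is a colour class. *)
Lemma component_cut (V : finType) (g : rel V) : symmetric g ->
  exists A : {set V}, (forall x y, g x y -> (x \in A) = (y \in A)) /\
    (#|[set u : V * V | ~~ connect g u.1 u.2]%SET| <= 4 * (#|A| * #|~: A|))%N.
Proof.
move=> /sym_connect_sym cs.
pose S (c : {ffun V -> bool}) := #|[set u : V * V | c (fingraph.root g u.1) != c (fingraph.root g u.2)]%SET|.
(* The colour of a component is read at its root, so that colourings of all
   the vertices can be counted. *)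
have [c Hc] : exists c, (#|[set u : V * V | ~~ connect g u.1 u.2]%SET| <= 2 * S c)%N.
  apply/existsP; apply: contraT; rewrite negb_exists => /forallP H.
  have : (\sum_(c : {ffun V -> bool}) 2 * S c <
     \sum_(c : {ffun V -> bool}) #|[set u : V * V | ~~ connect g u.1 u.2]%SET|)%N.
    apply: (@leq_trans (\sum_(c : {ffun V -> bool}) (2 * S c).+1)).
      rewrite (bigD1 [ffun=> true]) //= [leqRHS](bigD1 [ffun=> true]) //= -addSn leq_add2l.
      exact: leq_sum.
    by apply: leq_sum => c _; rewrite ltnNge H.
  rewrite ltnNge => /negP; case.
  rewrite sum_nat_const -big_distrr /= mulnC.
  have -> : (\sum_(c : {ffun V -> bool}) S c =
     \sum_(u : V * V) #|[set c : {ffun V -> bool} | c (fingraph.root g u.1) != c (fingraph.root g u.2)]%SET|)%N.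
    rewrite /S; under eq_bigr do rewrite -sum1dep_card big_mkcond.
    rewrite exchange_big /=; apply: eq_bigr => u _.
    by rewrite -sum1dep_card [RHS]big_mkcond.
  rewrite big_distrr /= -sum1dep_card big_distrl /= [leqLHS]big_mkcond /=.
  apply: leq_sum => u _; case: ifP => // nc.
  by rewrite mul1n card_differ // root_connect.
exists [set x | c (fingraph.root g x)]%SET; split.
  by move=> x y gxy; rewrite !inE; congr (c _); apply/eqP; rewrite root_connect // connect1.
apply: leq_trans Hc _; rewrite (_ : 4 = 2 * 2)%N // -mulnA leq_pmul2l //.
set A := [set x | c (fingraph.root g x)]%SET.
rewrite /S (_ : [set u | _]%SET = (finset.setX A (~: A) :|: finset.setX (~: A) A)%SET).
  by apply: leq_trans (leq_card_setU _ _) _; rewrite !cardsX [X in (_ + X)%N]mulnC addnn mul2n.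
by apply/setP => -[x y]; rewrite !inE /=; case: (c _); case: (c _).
Qed.

Definition nonconn (H : sgraph) := [set u : 'I_(nverts H) * 'I_(nverts H) |
   ~~ connect (@adj H) u.1 u.2]%SET.

(** The cut of [component_cut] with proportion a on one side satisfies
    a (1 - a) >= q / 4. So neither side is empty, and neither becomes negligible
    along a sequence of graphs with the same q. *)
Lemma sgraph_cut (R : realType) (H : sgraph) (q : R) : 0 < q ->
  q * (nverts H)%:R ^+ 2 <= (#|nonconn H|)%:R ->
  exists (a : R) (H1 H2 : sgraph), [/\ q / 4 <= a * (1 - a), 0 <= a <= 1,
    (nverts H1)%:R = a * (nverts H)%:R /\ (nverts H2)%:R = (1 - a) * (nverts H)%:R &
    forall F, sgraph_connected F -> hom_density R F H =
      a ^+ nverts F * hom_density R F H1 + (1 - a) ^+ nverts F * hom_density R F H2].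
Proof.
move=> q0 Hq; have [A [gA cA]] := component_cut (@adj_sym H).
set N := (nverts H)%:R : R.
have N0 : 0 < N by rewrite ltr0n nverts_gt0.
have cAA : (#|A| + #|~: A| = nverts H)%N by rewrite cardsC card_ord.
have cAR : (#|A|)%:R + (#|~: A|)%:R = N by rewrite -natrD cAA.
pose a : R := (#|A|)%:R / N.
have aN : (#|A|)%:R = a * N by rewrite /a divfK // gt_eqF.
have bN : (#|~: A|)%:R = (1 - a) * N by rewrite mulrBl mul1r -aN -cAR addrC addKr.
have a01 : 0 <= a <= 1.
  apply/andP; split; first by apply: divr_ge0 => //; exact: ltW.
  by rewrite ler_pdivrMr // mul1r -cAR lerDl ler0n.
have qa : q / 4 <= a * (1 - a).
  rewrite ler_pdivrMr // -(ler_pM2r (exprn_gt0 2 N0)); apply: (le_trans Hq).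
  rewrite (_ : a * (1 - a) * 4 * N ^+ 2 = 4 * ((a * N) * ((1 - a) * N))); last by ring.
  by rewrite -aN -bN -!natrM ler_nat.
have qa0 : 0 < a * (1 - a) by apply: lt_le_trans qa; rewrite divr_gt0.
have a0 : a != 0 by apply/eqP => E; move: qa0; rewrite E mul0r ltxx.
have b0 : 1 - a != 0 by apply/eqP => E; move: qa0; rewrite E mulr0 ltxx.
have /card_gt0P [x xA] : (0 < #|A|)%N.
  by rewrite -(ltr_nat R) aN mulr_gt0 // lt_def a0; case/andP: a01.
have /card_gt0P [y yA] : (0 < #|~: A|)%N.
  by rewrite -(ltr_nat R) bN mulr_gt0 // lt_def b0 subr_ge0; case/andP: a01.
rewrite inE in yA.
pose c : pred 'I_(nverts H) := mem A.
pose e1 : rel {u | c u} := relpre val (@adj H).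
pose e2 : rel {u | ~~ c u} := relpre val (@adj H).
have s1 : symmetric e1 by move=> u v; exact: adj_sym.
have s2 : symmetric e2 by move=> u v; exact: adj_sym.
have i1 : irreflexive e1 by move=> u; exact: adj_irr.
have i2 : irreflexive e2 by move=> u; exact: adj_irr.
have k1 : #|{: {u | c u}}| = #|A| by rewrite card_sig.
have k2 : #|{: {u | ~~ c u}}| = #|~: A| by rewrite card_sig; apply: eq_card => u; rewrite !inE.
exists a, (sgraph_of (exist c x xA) s1 i1), (sgraph_of (exist (fun u => ~~ c u) y yA) s2 i2).
split => //=; first by rewrite k1 k2.
move=> F cF.
rewrite !hom_densityE.
pose w1 (t : {u | c u}) : R := (#|A|)%:R^-1.
pose w2 (t : {u | ~~ c u}) : R := (#|~: A|)%:R^-1.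
have -> : wdensity (fun=> (nverts (sgraph_of (exist c x xA) s1 i1))%:R^-1) (@adj F)
  (@adj (sgraph_of (exist c x xA) s1 i1)) = wdensity w1 (@adj F) e1.
  rewrite (wdensity_bijr w1 (@adj F) e1 (enum_val_bijT _)).
  by apply: wdensity_eq => // t; rewrite /w1 /= k1.
have -> : wdensity (fun=> (nverts (sgraph_of (exist (fun u => ~~ c u) y yA) s2 i2))%:R^-1) (@adj F)
  (@adj (sgraph_of (exist (fun u => ~~ c u) y yA) s2 i2)) = wdensity w2 (@adj F) e2.
  rewrite (wdensity_bijr w2 (@adj F) e2 (enum_val_bijT _)).
  by apply: wdensity_eq => // t; rewrite /w2 /= k2.
have := wdensity_sumT a w1 w2 e1 e2 (vert0 F) cF; rewrite card_ord => <-.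
rewrite (wdensity_bijr _ _ _ (split_join_bij c)); apply: wdensity_eq => //.
  move=> [t|t] /=; rewrite /w1 /w2.
    by rewrite aN invfM mulrA divff // mul1r.
  by rewrite bN invfM mulrA divff // mul1r.
exact: relpre_split_join (@adj_sym H) gA.
Qed.

(** * Compactness of the space of graph limits *)

Definition sgraph_code (F : sgraph) : {n : nat & {set 'I_n * 'I_n}} :=
  existT (fun n => {set 'I_n * 'I_n}) (nverts F) [set p | adj p.1 p.2]%SET.

Lemma sgraph_code_inj : injective sgraph_code.
Proof.
move=> [n e n0 se ie] [n' e' n0' se' ie'] /eqP; rewrite /sgraph_code /= => E.
have nn : n = n' by case/andP: E => /eqP.
subst n'.
have eE : e = e'.
  move: E; rewrite -tag_eqE /tag_eq /= eqxx /= tagged_asE => /eqP /setP E.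
  apply/funext => x; apply/funext => y.
  by have := E (x, y); rewrite !inE.
subst e'.
by congr SGraph; exact: Prop_irrelevance.
Qed.

(** Serves to reach all the graphs by conditions on finitely many of them at a
    time. *)
Lemma sgraph_enum : exists dec : nat -> sgraph, forall F, exists k, dec k = F.
Proof.
have F0 : sgraph by exact: (@SGraph 1 (fun _ _ => false)).
pose enc F := pickle (sgraph_code F).
have enc_inj : injective enc by move=> F F' /(pcan_inj pickleK) /sgraph_code_inj.
have [dec decE] : {dec : nat -> sgraph & forall k, (exists F, enc F = k) -> enc (dec k) = k}.
  apply: (@choice _ _ (fun k F => (exists F, enc F = k) -> enc F = k)) => k.
  have [[F FE]|N] := pselect (exists F, enc F = k); first by exists F.
  by exists F0 => /N.
exists dec => F; exists (enc F); apply: enc_inj; apply: decE; by exists F.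
Qed.

(** A graph limit is defined by a sequence, whereas compactness gives limits
    along a filter. Since there are countably many graphs F, a diagonal choice
    extracts a sequence from the filter. *)
Lemma graph_limit_of_filter (R : realType) (U : set_system nat) (G : nat -> sgraph)
    (L : sgraph -> R) : ProperFilter U ->
  (forall N, \forall n \near U, (N <= nverts (G n))%N) ->
  (forall F, hom_density R F (G n) @[n --> U] --> L F) ->
  exists Gam : graph_limit R, tlim Gam = L.
Proof.
move=> PU vG cG; have [dec decP] := sgraph_enum.
have [s Hs] : {s : nat -> nat & forall M, (M <= nverts (G (s M)))%N /\
    forall k, (k < M)%N -> `|L (dec k) - hom_density R (dec k) (G (s M))| < M.+1%:R^-1}.
  apply: (@choice _ _ (fun M n => (M <= nverts (G n))%N /\
    forall k, (k < M)%N -> `|L (dec k) - hom_density R (dec k) (G n)| < M.+1%:R^-1)) => M.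
  have [n [H1 H2]] : exists n, (M <= nverts (G n))%N /\ (forall k : 'I_M,
      `|L (dec k) - hom_density R (dec k) (G n)| < M.+1%:R^-1).
    apply: (@filter_ex _ U PU); apply: filterI; first exact: vG.
    apply: filter_forall => k.
    by move/cvgrPdist_lt: (cG (dec k)); apply; rewrite invr_gt0.
  by exists n; split => // k kM; exact: (H2 (Ordinal kM)).
have vs : nverts (G (s n)) @[n --> \oo] --> \oo.
  move=> A [N _ NA]; exists N => // n /= Nn; apply: NA => /=.
  by apply: leq_trans Nn _; case: (Hs n).
have cs F : hom_density R F (G (s n)) @[n --> \oo] --> L F.
  have [k <-] := decP F; apply/cvgrPdist_lt => e e0.
  have [N _ HN] := near_infty_natSinv_lt (PosNum e0).
  exists (maxn N k.+1) => // n /=; rewrite geq_max => /andP [Nn kn].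
  by apply: lt_trans (HN n Nn); have [_] := Hs n; apply.
by exists (GraphLimit (ex_intro _ (fun n => G (s n)) (conj vs cs))).
Qed.

Lemma ultra_cvg (R : realType) (U : set_system nat) (f : nat -> R) :
  UltraFilter U -> (forall n, 0 <= f n <= 1) -> exists l : R, f n @[n --> U] --> l.
Proof.
move=> UU f01.
have := @segment_compact R 0 1; rewrite compact_ultra.
have fU : UltraFilter (f n @[n --> U]).
  split; first exact: fmap_proper_filter.
  move=> V PV sV; apply/seteqP; split => A; last exact: sV.
  have [UA|UA] := in_ultra_setVsetC (f @^-1` A) UU; first by [].
  move=> VA; exfalso.
  have VnA : V (~` A) by apply: sV.
  by apply: (@filter_not_empty _ V); rewrite -(setICr A); exact: filterI.
move=> /(_ _ fU) [|l [_ Hl]]; last by exists l.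
by apply: nearW => n; rewrite /= in_itv /=.
Qed.

Lemma hom_density01 (R : realType) (F G : sgraph) : 0 <= hom_density R F G <= 1.
Proof.
have u0 (t : 'I_(nverts G)) : 0 <= (nverts G)%:R^-1 :> R by rewrite invr_ge0.
by rewrite hom_densityE wdensity_ge0 // wdensity_le1 // sum_uniform.
Qed.

Lemma tlim01 (R : realType) (Gam : graph_limit R) (F : sgraph) : 0 <= tlim Gam F <= 1.
Proof.
have [G [_ cG]] := tlimP Gam; apply/andP; split.
  by apply: (cvgr_to_ge (cG F)); apply: nearW => n; case/andP: (hom_density01 R F (G n)).
by apply: (cvgr_to_le (cG F)); apply: nearW => n; case/andP: (hom_density01 R F (G n)).
Qed.

(** Every H_m splits along a cut that no edge crosses. Along an ultrafilter the
    proportions of the two sides and all the densities inside them converge,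
    and the exact mixture formulas of the H_m become the one for Gam. *)
Lemma limit_disconnected_of_nonconn (R : realType) (Gam : graph_limit R) (H : nat -> sgraph) (q : R) :
  0 < q -> (forall m, (m <= nverts (H m))%N) ->
  (forall F, hom_density R F (H m) @[m --> \oo] --> tlim Gam F) ->
  (forall m, q * (nverts (H m))%:R ^+ 2 <= (#|nonconn (H m)|)%:R) ->
  limit_disconnected Gam.
Proof.
move=> q0 vH cH ncH.
pose Pr m (z : R * sgraph * sgraph) := [/\ q / 4 <= z.1.1 * (1 - z.1.1), 0 <= z.1.1 <= 1,
    (nverts z.1.2)%:R = z.1.1 * (nverts (H m))%:R /\ (nverts z.2)%:R = (1 - z.1.1) * (nverts (H m))%:R &
    forall F, sgraph_connected F -> hom_density R F (H m) =
      z.1.1 ^+ nverts F * hom_density R F z.1.2 + (1 - z.1.1) ^+ nverts F * hom_density R F z.2].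
have [z Hz] : {z : nat -> R * sgraph * sgraph & forall m, Pr m (z m)}.
  apply: (@choice _ _ Pr) => m; have [a [H1 [H2 HH]]] := sgraph_cut q0 (ncH m).
  by exists (a, H1, H2).
have [U [UU sU]] := @ultraFilterLemma nat (nbhs \oo) _.
have [a ca] : exists a : R, (z m).1.1 @[m --> U] --> a.
  by apply: (@ultra_cvg R U (fun m => (z m).1.1)) => m; case: (Hz m).
have [L1 c1] : {L1 : sgraph -> R & forall F, hom_density R F (z m).1.2 @[m --> U] --> L1 F}.
  apply: (@choice _ _ (fun F l => hom_density R F (z m).1.2 @[m --> U] --> l)) => F.
  by apply: (@ultra_cvg R U (fun m => hom_density R F (z m).1.2)) => m; exact: hom_density01.
have [L2 c2] : {L2 : sgraph -> R & forall F, hom_density R F (z m).2 @[m --> U] --> L2 F}.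
  apply: (@choice _ _ (fun F l => hom_density R F (z m).2 @[m --> U] --> l)) => F.
  by apply: (@ultra_cvg R U (fun m => hom_density R F (z m).2)) => m; exact: hom_density01.
have cb : (1 - (z m).1.1) @[m --> U] --> 1 - a by apply: cvgB => //; exact: cvg_cst.
have qa : q / 4 <= a * (1 - a).
  by apply: (cvgr_to_ge (cvgM ca cb)); apply: nearW => m; case: (Hz m).
have a0 : 0 <= a by apply: (cvgr_to_ge ca); apply: nearW => m; case: (Hz m) => _ /andP [].
have a1 : a <= 1 by apply: (cvgr_to_le ca); apply: nearW => m; case: (Hz m) => _ /andP [].
have big (K : nat -> sgraph) (b : nat -> R) : (forall m, q / 4 <= b m) ->
    (forall m, (nverts (K m))%:R = b m * (nverts (H m))%:R) ->
    forall N, \forall n \near U, (N <= nverts (K n))%N.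
  move=> qb KE N; apply: sU.
  exists (Num.bound (N%:R / (q / 4))) => // m /= Nm.
  rewrite -(ler_nat R) KE; apply: (@le_trans _ _ (q / 4 * (nverts (H m))%:R)); last first.
    by rewrite ler_wpM2r.
  rewrite mulrC -ler_pdivrMr ?divr_gt0 //.
  have NB := @archi_boundP R (N%:R / (q / 4)).
  apply: ltW; apply: (lt_le_trans (NB _)).
    by rewrite divr_ge0 // ltW // divr_gt0.
  by rewrite ler_nat; apply: leq_trans Nm (vH m).
have [Gam1 E1] : exists Gam1 : graph_limit R, tlim Gam1 = L1.
  apply: (@graph_limit_of_filter R U (fun m => (z m).1.2)) => //.
  apply: (big _ (fun m => (z m).1.1)) => m; case: (Hz m) => h1 /andP [h2 h3] [h4 h5] _ //.
  by apply: le_trans h1 _; rewrite -[leRHS]mulr1 ler_wpM2l // gerBl.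
have [Gam2 E2] : exists Gam2 : graph_limit R, tlim Gam2 = L2.
  apply: (@graph_limit_of_filter R U (fun m => (z m).2)) => //.
  apply: (big _ (fun m => 1 - (z m).1.1)) => m; case: (Hz m) => h1 /andP [h2 h3] [h4 h5] _ //.
  by apply: le_trans h1 _; rewrite -[leRHS]mul1r ler_wpM2r // subr_ge0.
exists Gam1, Gam2, a; split.
  have qa0 : 0 < a * (1 - a) by apply: lt_le_trans qa; rewrite divr_gt0.
  rewrite !lt_neqAle a0 a1 !andbT; apply/andP; split; apply/eqP => E; move: qa0.
    by rewrite -E mul0r ltxx.
  by rewrite E subrr mulr0 ltxx.
move=> F cF; rewrite E1 E2.
have cHU : hom_density R F (H m) @[m --> U] --> tlim Gam F by move=> A /(cH F); exact: sU.
rewrite -(cvg_lim (@Rhausdorff R) cHU); apply: cvg_lim => //.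
rewrite (_ : (fun m => _) = fun m => (z m).1.1 ^+ nverts F * hom_density R F (z m).1.2 +
    (1 - (z m).1.1) ^+ nverts F * hom_density R F (z m).2); last first.
  by apply/funext => m; case: (Hz m) => _ _ _; apply.
by apply: cvgD; apply: cvgM => //; exact: cvgrX.
Qed.

(** * Connected limits *)

(** The ratio is the probability that a random map from k to n.+1 points is
    injective. *)
Lemma ffact_ratio (R : realType) (n k : nat) :
  1 - (k ^ 2)%:R / n.+1%:R <= ((n.+1 ^_ k)%:R / n.+1%:R ^+ k : R) <= 1.
Proof.
have N0 : 0 < n.+1%:R :> R by rewrite ltr0n.
elim: k => [|k /andP [IH1 IH2]].
  by rewrite ffactn0 expr0 exp0n // mul0r subr0 divr1 lexx.
set r := (n.+1 ^_ k)%:R / n.+1%:R ^+ k in IH1 IH2.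
have r0 : 0 <= r by rewrite /r divr_ge0 ?ler0n ?exprn_ge0.
have -> : (n.+1 ^_ k.+1)%:R / n.+1%:R ^+ k.+1 = r * ((n.+1 - k)%:R / n.+1%:R) :> R.
  by rewrite ffactnSr natrM exprSr invfM mulrACA.
have s1 : (n.+1 - k)%:R / n.+1%:R <= 1 :> R.
  by rewrite ler_pdivrMr // mul1r ler_nat leq_subr.
have s2 : 1 - k%:R / n.+1%:R <= (n.+1 - k)%:R / n.+1%:R :> R.
  rewrite ler_pdivlMr // mulrBl mul1r divfK ?gt_eqF // lerBlDr -natrD ler_nat.
  by rewrite addnC -leq_subLR.
have s0 : 0 <= (n.+1 - k)%:R / n.+1%:R :> R by rewrite divr_ge0.
apply/andP; split; last by apply: mulr_ile1.
have k0 : 0 <= k%:R / n.+1%:R :> R by rewrite divr_ge0.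
have kk : (k.+1 ^ 2)%:R / n.+1%:R = (k ^ 2)%:R / n.+1%:R + (2 * (k%:R / n.+1%:R)) + n.+1%:R^-1 :> R.
  rewrite -addn1 !natrX natrD; field; exact: lt0r_neq0.
have i0 : 0 <= n.+1%:R^-1 :> R by rewrite invr_ge0.
apply: (@le_trans _ _ (r * (1 - k%:R / n.+1%:R))); last by rewrite ler_wpM2l.
rewrite kk mulrBr mulr1.
have : r * (k%:R / n.+1%:R) <= k%:R / n.+1%:R by rewrite ler_piMl.
move: IH1 k0 i0; set x := k%:R / _; set y := (k ^ 2)%:R / _; set z := _^-1.
by clearbody r x y z; lra.
Qed.

Section concentration.
Context (R : realType) (d : measure_display) (Om : measurableType d)
  (P : probability Om R) (Gam : graph_limit R) (G : Om -> rel nat).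
Hypothesis hG : is_G_infty P Gam G.

Let incl n : 'I_n.+1 -> nat := @nat_of_ord n.+1.
Let law n := graph_law P G (@incl n).
Arguments law : clear implicits.

Lemma incl_inj n : injective (@incl n). Proof. exact: val_inj. Qed.

Lemma law_ge0 n K : 0 <= law n K. Proof. exact: graph_law_ge0. Qed.

Lemma law_sum1 n : \sum_K law n K = 1.
Proof.
apply: EFin_inj; rewrite -(graph_law_event hG (@incl n) (fun=> true)).
rewrite (_ : [set w | _] = setT); first exact: probability_setT.
by apply/seteqP; split.
Qed.

Lemma adj_edge_code n (phi : 'I_n.+1 -> nat) w x y :
  @adj (edge_graph (edge_code G phi w)) x y = G w (phi x) (phi y).
Proof.
have [sG iG _ _] := hG; rewrite /= !inE /= (sG w (phi y)) orbb.
by have [->|] := eqVneq x y; rewrite ?iG.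
Qed.

Definition mean n (X : {set 'I_n.+1 * 'I_n.+1} -> R) := \sum_K law n K * X K.

Lemma law_event01 n (E : pred {set 'I_n.+1 * 'I_n.+1}) :
  0 <= \sum_(K | E K) law n K <= 1.
Proof.
apply/andP; split; first by apply: sumr_ge0 => K _; exact: law_ge0.
rewrite -(law_sum1 n) big_mkcond; apply: ler_sum => K _.
by case: ifP => // _; exact: law_ge0.
Qed.

(** An injective map F -> {0, ..., n} is a homomorphism with probability exactly
    t(F, Gam); only the non-injective maps contribute to the error. *)
Lemma mean_hom_density n (F : sgraph) :
  `|mean (fun K : {set 'I_n.+1 * 'I_n.+1} => hom_density R F (edge_graph K)) - tlim Gam F|
  <= (nverts F ^ 2)%:R / n.+1%:R.
Proof.
set k := nverts F.
pose c (f : {ffun 'I_k -> 'I_n.+1}) := \sum_(K | rel_hom (@adj F) (@adj (edge_graph K)) f) law n K.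
pose u : R := n.+1%:R^-1 ^+ k.
have N0 : 0 < n.+1%:R :> R by rewrite ltr0n.
have u0 : 0 <= u by rewrite exprn_ge0 // invr_ge0.
have uN : \sum_(f : {ffun 'I_k -> 'I_n.+1}) u = 1.
  by rewrite sumr_const card_ffun !card_ord /u -[LHS]mulr_natl natrX -exprMn divff ?expr1n.
have meanE : mean (fun K : {set 'I_n.+1 * 'I_n.+1} => hom_density R F (edge_graph K)) = \sum_f u * c f.
  transitivity (\sum_K \sum_(f : {ffun 'I_k -> 'I_n.+1})
      if rel_hom (@adj F) (@adj (edge_graph K)) f then law n K * u else 0).
    rewrite /mean; apply: eq_bigr => K _; rewrite hom_densityE /wdensity mulr_sumr [LHS]big_mkcond.
    by apply: eq_bigr => f _; case: ifP => // _; rewrite prodr_const card_ord.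
  rewrite exchange_big /=; apply: eq_bigr => f _; rewrite /c mulr_sumr [RHS]big_mkcond.
  apply: eq_bigr => K _; case: ifP => // _.
  exact: mulrC.
have cinj (f : {ffun 'I_k -> 'I_n.+1}) : injective f -> c f = tlim Gam F.
  move=> f_inj; apply: EFin_inj; rewrite -(graph_law_event hG).
  have finj : injective (fun x => @incl n (f x)) by move=> x y /incl_inj /f_inj.
  rewrite -(prob_subgraph hG finj); congr (P _).
  apply/eq_set => w; apply/propext; split => [/rel_homP H x y xy|H].
    by rewrite -adj_edge_code; exact: H.
  by apply/rel_homP => x y xy; rewrite adj_edge_code; exact: H.
have -> : mean (fun K : {set 'I_n.+1 * 'I_n.+1} => hom_density R F (edge_graph K)) - tlim Gam F =
    \sum_(f : {ffun 'I_k -> 'I_n.+1}) u * (c f - tlim Gam F).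
  rewrite meanE; under [RHS]eq_bigr do rewrite mulrBr.
  by rewrite sumrB -[X in _ = _ - X]mulr_suml uN mul1r.
apply: le_trans (ler_norm_sum _ _ _) _.
apply: (@le_trans _ _ (\sum_(f : {ffun 'I_k -> 'I_n.+1}) (u - if injectiveb f then u else 0))).
  apply: ler_sum => f _; rewrite normrM (ger0_norm u0).
  case: injectiveP => [/cinj ->|_]; first by rewrite !subrr normr0 mulr0.
  rewrite subr0 ler_piMr // ler_norml.
  have /andP [] := tlim01 Gam F; have /andP [] := @law_event01 n (fun K => rel_hom (@adj F) (@adj (edge_graph K)) f).
  rewrite -/(c f); lra.
rewrite sumrB uN -big_mkcond sumr_const.
have -> : #|(fun f : {ffun 'I_k -> 'I_n.+1} => injectiveb f)| = (n.+1 ^_ k)%N.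
  by rewrite -[in RHS](card_ord n.+1) -[in RHS](card_ord k) -card_inj_ffuns cardsE.
have /andP [] := ffact_ratio R n k.
by rewrite -(mulr_natl u) /u exprVn => h _; rewrite lerBlDr addrC -lerBlDr.
Qed.

Lemma mean_linear n (X Y : {set 'I_n.+1 * 'I_n.+1} -> R) (a b : R) :
  mean (fun K => X K + a * Y K + b) = mean X + a * mean Y + b.
Proof.
rewrite /mean mulr_sumr -[b in RHS]mul1r -(law_sum1 n) mulr_suml -!big_split /=.
by apply: eq_bigr => K _; rewrite !mulrDr mulrCA.
Qed.

(** The square of the density of F is the density of two disjoint copies of F,
    and t(F + F, Gam) = t(F, Gam)^2: with k vertices in F, the second moment is off
    by at most 4 k^2 / (n+1) and the first by at most k^2 / (n+1), taken twice. *)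
Lemma variance_hom_density n (F : sgraph) :
  mean (fun K : {set 'I_n.+1 * 'I_n.+1} => (hom_density R F (edge_graph K) - tlim Gam F) ^+ 2)
  <= (6 * nverts F ^ 2)%:R / n.+1%:R.
Proof.
set t := tlim Gam F; set k := nverts F.
have -> : mean (fun K : {set 'I_n.+1 * 'I_n.+1} => (hom_density R F (edge_graph K) - t) ^+ 2) =
  mean (fun K : {set 'I_n.+1 * 'I_n.+1} => hom_density R (sgraph_double F) (edge_graph K) +
    (- 2 * t) * hom_density R F (edge_graph K) + t ^+ 2).
  apply: eq_bigr => K _; congr (_ * _).
  rewrite [hom_density _ (sgraph_double F) _]hom_densityE wdensity_double -hom_densityE; ring.
rewrite mean_linear.
have m1 := mean_hom_density n F; have m2 := mean_hom_density n (sgraph_double F).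
rewrite tlim_double -/t in m2; rewrite -/t -/k in m1.
have k2 : nverts (sgraph_double F) = (2 * k)%N by rewrite /= card_sum card_ord mul2n addnn.
rewrite k2 expnMn natrM in m2; rewrite natrM -[leRHS]mulrA.
move: m1 m2; rewrite !ler_norml => /andP [m1 m1'] /andP [m2 m2'].
have /andP [t0 t1] := tlim01 Gam F; rewrite -/t in t0 t1.
set e := (k ^ 2)%:R / n.+1%:R in m1 m1'.
rewrite -mulrA -/e in m2 m2'; rewrite -/e.
set A := mean _ in m1 m1' *; set B := mean _ in m2 m2' *.
have e0 : 0 <= e by rewrite divr_ge0.
have h : t * (t - A) <= e.
  apply: (@le_trans _ _ (t * e)); first by rewrite ler_wpM2l //; clearbody e A; lra.
  by rewrite ler_piMl.
have -> : B + -2 * t * A + t ^+ 2 = (B - t ^+ 2) + 2 * (t * (t - A)) by ring.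
rewrite (_ : (2 ^ 2)%:R = 4) // in m2'; move: m2' h.
set x := B - _; set y := t * _; clearbody e x y; lra.
Qed.

Lemma exists_gt_mean n (X : {set 'I_n.+1 * 'I_n.+1} -> R) (c : R) : c < mean X -> exists K, c < X K.
Proof.
move=> cX; apply/not_existsP => H; move: cX; apply/negP; rewrite -leNgt.
rewrite -[leRHS]mul1r -(law_sum1 n) mulr_suml; apply: ler_sum => K _.
by apply: ler_wpM2l; [exact: law_ge0|rewrite leNgt; apply/negP/H].
Qed.

(** A permutation of the vertices that moves i0 to i and j0 to j preserves the
    law. *)
Lemma nonconn_exchange n (i0 j0 i j : 'I_n.+1) : i0 != j0 -> i != j ->
  \sum_(K | (i0, j0) \in nonconn (edge_graph K)) law n K <=
  \sum_(K | (i, j) \in nonconn (edge_graph K)) law n K.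
Proof.
move=> ij0 ij.
(* The second transposition corrects the image of j0 and leaves i in place. *)
pose s : {perm 'I_n.+1} := (tperm i0 i * tperm (tperm i0 i j0) j)%g.
have si : s i0 = i.
  have ji : j != i by rewrite eq_sym.
  have kj : tperm i0 i j0 != i.
    by apply: contraNneq ij0 => E; apply/eqP/(@perm_inj _ (tperm i0 i)); rewrite tpermL E.
  by rewrite /s permM tpermL; exact: tpermD.
have sj : s j0 = j by rewrite /s permM tpermL.
pose phi x := @incl n (s x).
have phi_inj : injective phi by move=> x y /incl_inj /perm_inj.
rewrite (eq_bigr (graph_law P G phi)); last first.
  by move=> K _; apply: (graph_law_exchangeable hG) => //; exact: incl_inj.
rewrite -lee_fin -(graph_law_event hG phi (fun K => (i0, j0) \in nonconn (edge_graph K))).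
rewrite -(graph_law_event hG (@incl n) (fun K => (i, j) \in nonconn (edge_graph K))).
apply: le_measure; [apply/mem_set; exact: (measurable_event hG phi (fun K => (i0, j0) \in nonconn (edge_graph K)))
  |apply/mem_set; exact: (measurable_event hG (@incl n) (fun K => (i, j) \in nonconn (edge_graph K)))|].
move=> w; rewrite /= !inE; apply: contra => c.
have h x y : @adj (edge_graph (edge_code G (@incl n) w)) x y ->
    connect (@adj (edge_graph (edge_code G phi w))) ((s^-1)%g x) ((s^-1)%g y).
  rewrite adj_edge_code => xy; apply: connect1.
  by rewrite adj_edge_code /phi !permKV.
by rewrite -[i0](permK s) -[j0](permK s) si sj; exact: connect_homo h _ _ c.
Qed.

Lemma mean_nonconn n (i0 j0 : 'I_n.+1) (q : R) : i0 != j0 ->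
  q <= \sum_(K | (i0, j0) \in nonconn (edge_graph K)) law n K ->
  (n.+1 * n)%:R * q <= mean (fun K : {set 'I_n.+1 * 'I_n.+1} => (#|nonconn (edge_graph K)|)%:R).
Proof.
move=> ij0 hq.
have -> : mean (fun K : {set 'I_n.+1 * 'I_n.+1} => (#|nonconn (edge_graph K)|)%:R) =
    \sum_(u : 'I_n.+1 * 'I_n.+1) \sum_(K | u \in nonconn (edge_graph K)) law n K.
  rewrite (exchange_big_dep xpredT) //=; apply: eq_bigr => K _.
  by rewrite sumr_const mulr_natr.
rewrite (bigID (fun u => u.1 != u.2)) /= -[leLHS]addr0; apply: lerD; last first.
  by apply: sumr_ge0 => u _; case/andP: (law_event01 (fun K => u \in nonconn (edge_graph K))).
apply: (@le_trans _ _ (\sum_(u : 'I_n.+1 * 'I_n.+1 | u.1 != u.2) q)).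
  rewrite -(pair_big_dep xpredT (fun i j : 'I_n.+1 => i != j) (fun _ _ => q)) /=.
  rewrite (eq_bigr (fun=> q *+ n)); last first.
    move=> i _; rewrite sumr_const; congr (q *+ _).
    rewrite -[RHS]/(n.+1.-1) -[in RHS](card_ord n.+1) -(cardC1 i).
    by apply: eq_card => j; rewrite !inE eq_sym.
  by rewrite sumr_const card_ord -mulrnA mulr_natl mulnC.
apply: ler_sum => -[i j] /= ij; apply: le_trans hq _; exact: nonconn_exchange.
Qed.

(** One random quantity has to be large, the proportion D / (n+1)^2 of
    disconnected pairs, and another small, the sum V of squared deviations.
    For large n the mean of D / (n+1)^2 - (m+1) V exceeds q / 2, so some outcome
    exceeds it; there D / (n+1)^2 > q / 2 because V >= 0, and (m+1) V < 1 because
    D <= (n+1)^2. *)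
Lemma exists_fragmented_graph (i0 j0 : nat) (q : R) : 0 < q -> q <= 1 ->
  (forall n (i j : 'I_n.+1), i0 = i -> j0 = j -> 
     q <= \sum_(K | (i, j) \in nonconn (edge_graph K)) law n K) ->
  i0 != j0 ->
  forall (dec : nat -> sgraph) (m : nat), exists H : sgraph,
    [/\ (m <= nverts H)%N, q / 2 * (nverts H)%:R ^+ 2 <= (#|nonconn H|)%:R &
     \sum_(k < m) (hom_density R (dec k) H - tlim Gam (dec k)) ^+ 2 <= m.+1%:R^-1].
Proof.
move=> q0 q1 hq ij0 dec m.
pose C : R := \sum_(k < m) (6 * nverts (dec k) ^ 2)%:R.
have C0 : 0 <= C by apply: sumr_ge0.
pose B : R := m.+1%:R * C.
have B0 : 0 <= B by rewrite mulr_ge0.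
pose n := (m + i0 + j0 + Num.bound (2 * (1 + B) / q))%N.
have nB : 2 * (1 + B) < q * n%:R.
  have x0 : 0 <= 2 * (1 + B) / q by rewrite divr_ge0 ?(ltW q0) // mulr_ge0 // addr_ge0.
  rewrite [ltRHS]mulrC -ltr_pdivrMr //; apply: (lt_le_trans (archi_boundP x0)).
  by rewrite ler_nat leq_addl.
have i0n : (i0 < n.+1)%N by rewrite ltnS /n -!addnA addnCA leq_addr.
have j0n : (j0 < n.+1)%N by rewrite ltnS /n addnAC leq_addl.
have N0 : 0 < n.+1%:R :> R by rewrite ltr0n.
pose D (K : {set 'I_n.+1 * 'I_n.+1}) : R := (#|nonconn (edge_graph K)|)%:R.
pose V (K : {set 'I_n.+1 * 'I_n.+1}) : R :=
  \sum_(k < m) (hom_density R (dec k) (edge_graph K) - tlim Gam (dec k)) ^+ 2.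
have mV : mean V <= C / n.+1%:R.
  rewrite /mean /V /C mulr_suml; under eq_bigr do rewrite mulr_sumr.
  by rewrite exchange_big /=; apply: ler_sum => k _; exact: variance_hom_density.
have mD : (n.+1 * n)%:R * q <= mean D.
  apply: (@mean_nonconn n (Ordinal i0n) (Ordinal j0n)); first by rewrite -val_eqE.
  exact: hq.
have [K HK] : exists K, q / 2 < D K / n.+1%:R ^+ 2 - m.+1%:R * V K.
  apply: exists_gt_mean.
  have -> : mean (fun K => D K / n.+1%:R ^+ 2 - m.+1%:R * V K) =
      mean D / n.+1%:R ^+ 2 - m.+1%:R * mean V.
    rewrite /mean mulr_suml mulr_sumr -sumrB; apply: eq_bigr => L _.
    rewrite /=; ring.
  have h1 : n%:R * q / n.+1%:R <= mean D / n.+1%:R ^+ 2.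
    rewrite expr2 invfM mulrA ler_pM2r ?invr_gt0 // ler_pdivlMr //.
    by rewrite mulrC mulrA -natrM.
  have h2 : m.+1%:R * mean V <= B / n.+1%:R by rewrite /B -mulrA ler_wpM2l.
  apply: (@lt_le_trans _ _ (n%:R * q / n.+1%:R - B / n.+1%:R)); last exact: lerB.
  rewrite -mulrBl ltr_pdivlMr // -[n.+1%:R]natr1; move: nB q1; clearbody B.
  by move: (n%:R) => x; lra.
have D1 : D K / n.+1%:R ^+ 2 <= 1.
  rewrite ler_pdivrMr ?exprn_gt0 // mul1r -natrX ler_nat.
  by apply: leq_trans (max_card _) _; rewrite card_prod card_ord.
have V0 : 0 <= V K by apply: sumr_ge0 => k _; exact: sqr_ge0.
exists (edge_graph K); split.
- by rewrite /= /n -!addnA leqW // leq_addr.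
- rewrite /= -ler_pdivlMr ?exprn_gt0 //; apply: ltW; apply: (lt_le_trans HK).
  by rewrite gerBl mulr_ge0.
- rewrite -/(V K) -[leRHS]mul1r ler_pdivlMr // mulrC.
  have q2 : 0 < q / 2 by rewrite divr_gt0.
  by move: HK D1 q2; move: (D K / _) (_ * V K) (q / 2) => x y z; lra.
Qed.

(** If G is disconnected, some pair of vertices is disconnected in every finite
    restriction of G. When this has positive probability for one pair,
    [exists_fragmented_graph] provides graphs that converge to Gam and stay
    fragmented, and Gam is disconnected. *)
Lemma connected_ae : limit_connected Gam -> {ae P, forall w, igraph_connected (G w)}.
Proof.
move=> cGam.
(* For n < i or n < j the quantifiers are empty, and the event E i j n is certain. *)
pose E i j n : pred {set 'I_n.+1 * 'I_n.+1} := fun K =>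
  [forall a : 'I_n.+1, forall b : 'I_n.+1,
     (val a == i) && (val b == j) ==> ((a, b) \in nonconn (edge_graph K))].
pose Q i j := \bigcap_n [set w | E i j n (edge_code G (@incl n) w)].
have mE i j n : measurable [set w | E i j n (edge_code G (@incl n) w)].
  exact: (measurable_event hG (@incl n) (E i j n)).
have mQ i j : measurable (Q i j) by apply: bigcapT_measurable => n; exact: mE.
have Q0 i j : P (Q i j) = 0%E.
  apply: contrapT => PQ; apply: cGam.
  have PQfin : P (Q i j) \is a fin_num by exact: fin_num_measure.
  pose q := fine (P (Q i j)).
  have qE : P (Q i j) = q%:E by rewrite fineK.
  have q0 : 0 < q.
    by rewrite lt_def fine_ge0 // andbT; apply/eqP => q0; apply: PQ; rewrite qE q0.
  have q1 : q <= 1 by rewrite -lee_fin -qE; exact: probability_le1.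
  have hq n (a b : 'I_n.+1) : i = a -> j = b ->
      q <= \sum_(K | (a, b) \in nonconn (edge_graph K)) law n K.
    move=> ia jb; rewrite -lee_fin -qE.
    rewrite -(graph_law_event hG (@incl n) (fun K => (a, b) \in nonconn (edge_graph K))).
    apply: le_measure; [exact/mem_set|apply/mem_set|].
      exact: (measurable_event hG (@incl n) (fun K => (a, b) \in nonconn (edge_graph K))).
    move=> w /(_ n I) /forallP /(_ a) /forallP /(_ b) /implyP; apply.
    by rewrite ia jb !eqxx.
  have ij : i != j.
    apply/eqP => ij; apply: PQ; rewrite (_ : Q i j = set0) ?measure0 //.
    apply/seteqP; split => // w /(_ i I) /forallP /(_ ord_max) /forallP /(_ ord_max).
    by rewrite /= ij !eqxx /= inE connect0.
  have [dec decP] := sgraph_enum.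
  have [H HP] : {H : nat -> sgraph & forall m,
     [/\ (m <= nverts (H m))%N, q / 2 * (nverts (H m))%:R ^+ 2 <= (#|nonconn (H m)|)%:R &
     \sum_(k < m) (hom_density R (dec k) (H m) - tlim Gam (dec k)) ^+ 2 <= m.+1%:R^-1]}.
    by apply: (@choice _ _ (fun m (H : sgraph) =>
      [/\ (m <= nverts H)%N, q / 2 * (nverts H)%:R ^+ 2 <= (#|nonconn H|)%:R &
       \sum_(k < m) (hom_density R (dec k) H - tlim Gam (dec k)) ^+ 2 <= m.+1%:R^-1])) => m;
      exact: exists_fragmented_graph q0 q1 hq ij dec m.
  apply: (@limit_disconnected_of_nonconn R Gam H (q / 2)).
  - by rewrite divr_gt0.
  - by move=> m; case: (HP m).
  - move=> F; have [k <-] := decP F; apply/cvgrPdist_lt => e e0.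
    have e2 : 0 < e ^+ 2 by rewrite exprn_gt0.
    have [M _ HM] := near_infty_natSinv_lt (PosNum e2).
    exists (maxn M k.+1) => // m /=; rewrite geq_max => /andP [Mm km].
    have [_ _ Hm] := HP m.
    rewrite distrC -(ltr_pXn2r (n := 2)) ?nnegrE ?(ltW e0) // real_normK ?num_real //.
    apply: le_lt_trans (HM m Mm); apply: le_trans Hm.
    rewrite (bigD1 (Ordinal km)) //= lerDl.
    by apply: sumr_ge0 => l _; exact: sqr_ge0.
  - by move=> m; case: (HP m).
have NQ : P.-negligible (\bigcup_i \bigcup_j Q i j).
  apply: negligible_bigcup => i; apply: negligible_bigcup => j.
  by apply/(negligibleP _ (mQ i j)); exact: Q0.
apply: negligibleS NQ => w /= /existsNP [i /existsNP [j nij]].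
exists i => //; exists j => // n _; apply/forallP => a; apply/forallP => b.
apply/implyP => /andP [/eqP ai /eqP bj]; rewrite inE; apply/negP => c.
apply: nij; move: c => /connectP [p pp lp]; exists [seq val x | x <- p]; last first.
  by rewrite -ai last_map -lp bj.
rewrite -ai; apply: homo_path pp => x y.
by rewrite adj_edge_code.
Qed.

End concentration.

Theorem theorem1p19 (R : realType) (Gam : graph_limit R)
    (d : measure_display) (Om : measurableType d) (P : probability Om R)
    (G : Om -> rel nat) (hG : is_G_infty P Gam G) :
  (limit_connected Gam -> {ae P, forall w, igraph_connected (G w)}) /\
  (limit_disconnected Gam -> {ae P, forall w, ~ igraph_connected (G w)}).
Proof. by split; [exact: connected_ae hG|exact: disconnected_ae hG]. Qed.
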